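(* Given a laminar family $\mathcal R$ of $n$ axis-parallel rectangles in the plane, one can compute the inclusion forest of $\mathcal R$ in time $O(n\log n)$.
   Context: A family $\mathcal F$ of subsets of a universe is laminar if for any $X,Y\in\mathcal F$, either $X\cap Y=\emptyset$, $X\subseteq Y$, or $Y\subseteq X$. For a laminar family not containing the empty set, its inclusion forest is the rooted forest whose nodes are the members of $\mathcal F$ and in which $X$ is an ancestor of $Y$ iff $Y\subseteq X$. *)

(* Defs.v *)
From mathcomp Require Import all_boot all_order all_algebra.
From mathcomp Require Import boolp classical_sets reals topology normedtype.
From mathcomp Require Import landau exp.
Set Implicit Arguments.
Unset Strict Implicit.
Unset Printing Implicit Defensive.
Import Order.TTheory GRing.Theory Num.Theory.
Import numFieldNormedType.Exports.
Local Open Scope classical_set_scope.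
Local Open Scope ring_scope.

Definition laminar (T : Type) (F : set (set T)) : Prop :=
  forall X Y : set T, F X -> F Y ->
    X `&` Y = set0 \/ X `<=` Y \/ Y `<=` X.

(* A rooted forest on the node type I is given by its parent function, roots   *)
(* being sent to None.  [up p k i] climbs k edges from i, [None] once the walk *)
(* has left the forest through a root.                                         *)
Definition up (I : Type) (p : I -> option I) (k : nat) (i : I) : option I :=
  iter k (obind p) (Some i).

Definition rooted_forest (I : Type) (p : I -> option I) : Prop :=
  forall i : I, exists k : nat, up p k i = None.

(* Reflexive, as required by "X is an ancestor of Y iff Y is included in X".   *)
Definition ancestor (I : Type) (p : I -> option I) (i j : I) : Prop :=
  exists k : nat, up p k j = Some i.

(* The family is the image of A; I names its members when A is injective.      *)
Definition inclusion_forest (I T : Type) (A : I -> set T) (p : I -> option I)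
  : Prop :=
  rooted_forest p /\ forall i j : I, ancestor p i j <-> A j `<=` A i.

Record rectangle (R : realType) := Rectangle {
  xmin : R; xmax : R; ymin : R; ymax : R;
  xmin_le_xmax : xmin <= xmax;
  ymin_le_ymax : ymin <= ymax }.

Definition region (R : realType) (r : rectangle R) : set (R * R) :=
  [set z | (xmin r <= z.1 <= xmax r) /\ (ymin r <= z.2 <= ymax r)].

(* The real RAM: unit-cost operations on machine words and on exact reals.     *)
(* Words are the naturals below a bound B; evaluation is stuck (None) on a     *)
(* word overflow and on a real division by zero.  Variables and arrays are     *)
(* named by literal naturals, so a program has finitely many of them; array    *)
(* indices are words.  Reals are never converted to words, and the only        *)
(* literals are word literals, so no information can hide in the program.      *)

Inductive word_op := WAdd | WSub | WMul | WDiv.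
Inductive real_op := RAdd | RSub | RMul | RDiv.

Inductive wexp :=
  | WLit of nat
  | WVar of nat
  | WGet of nat & wexp
  | WBin of word_op & wexp & wexp.

Inductive rexp :=
  | RWord of wexp
  | RVar of nat
  | RGet of nat & wexp
  | RBin of real_op & rexp & rexp.

Inductive bexp :=
  | WLe of wexp & wexp
  | RLe of rexp & rexp
  | BNot of bexp
  | BAnd of bexp & bexp.

Inductive cmd :=
  | Skip
  | WSet of nat & wexp
  | RSet of nat & rexp
  | WPut of nat & wexp & wexp
  | RPut of nat & wexp & rexp
  | Seq of cmd & cmd
  | If of bexp & cmd & cmd
  | While of bexp & cmd.

Record state (R : realType) := State {
  wvar : nat -> nat;
  warr : nat -> nat -> nat;
  rvar : nat -> R;
  rarr : nat -> nat -> R }.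

Definition upd (V : Type) (f : nat -> V) (x : nat) (v : V) : nat -> V :=
  fun y => if y == x then v else f y.

Definition set_wvar (R : realType) (s : state R) (x v : nat) : state R :=
  State (upd (wvar s) x v) (warr s) (rvar s) (rarr s).
Definition set_rvar (R : realType) (s : state R) (x : nat) (v : R) : state R :=
  State (wvar s) (warr s) (upd (rvar s) x v) (rarr s).
Definition set_warr (R : realType) (s : state R) (a i v : nat) : state R :=
  State (wvar s) (upd (warr s) a (upd (warr s a) i v)) (rvar s) (rarr s).
Definition set_rarr (R : realType) (s : state R) (a i : nat) (v : R) : state R :=
  State (wvar s) (warr s) (rvar s) (upd (rarr s) a (upd (rarr s a) i v)).

Definition word (B m : nat) : option nat := if (m < B)%N then Some m else None.

(* Truncated subtraction; Euclidean quotient, with m %/ 0 = 0.                 *)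
Definition word_op_sem (o : word_op) : nat -> nat -> nat :=
  match o with WAdd => addn | WSub => subn | WMul => muln | WDiv => divn end.

Definition real_op_sem (R : realType) (o : real_op) (x y : R) : option R :=
  match o with
  | RAdd => Some (x + y)
  | RSub => Some (x - y)
  | RMul => Some (x * y)
  | RDiv => if y == 0 then None else Some (x / y)
  end.

Fixpoint weval (R : realType) (B : nat) (s : state R) (e : wexp) : option nat :=
  match e with
  | WLit m => word B m
  | WVar x => Some (wvar s x)
  | WGet a e1 => omap (warr s a) (weval B s e1)
  | WBin o e1 e2 =>
      obind (fun m1 => obind (fun m2 => word B (word_op_sem o m1 m2))
                             (weval B s e2)) (weval B s e1)
  end.

Fixpoint reval (R : realType) (B : nat) (s : state R) (e : rexp) : option R :=
  match e with
  | RWord e1 => omap (fun m : nat => m%:R) (weval B s e1)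
  | RVar x => Some (rvar s x)
  | RGet a e1 => omap (rarr s a) (weval B s e1)
  | RBin o e1 e2 =>
      obind (fun x1 => obind (real_op_sem o x1) (reval B s e2)) (reval B s e1)
  end.

Fixpoint beval (R : realType) (B : nat) (s : state R) (b : bexp) : option bool :=
  match b with
  | WLe e1 e2 =>
      obind (fun m1 => omap (fun m2 => (m1 <= m2)%N) (weval B s e2))
            (weval B s e1)
  | RLe e1 e2 =>
      obind (fun x1 : R => omap (fun x2 : R => x1 <= x2) (reval B s e2))
            (reval B s e1)
  | BNot b1 => omap negb (beval B s b1)
  | BAnd b1 b2 =>
      obind (fun v1 => omap (andb v1) (beval B s b2)) (beval B s b1)
  end.

(* Evaluating an expression costs one unit per node.                           *)
Fixpoint wcost (e : wexp) : nat :=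
  match e with
  | WLit _ | WVar _ => 1
  | WGet _ e1 => (wcost e1).+1
  | WBin _ e1 e2 => (wcost e1 + wcost e2).+1
  end.

Fixpoint rcost (e : rexp) : nat :=
  match e with
  | RVar _ => 1
  | RWord e1 | RGet _ e1 => (wcost e1).+1
  | RBin _ e1 e2 => (rcost e1 + rcost e2).+1
  end.

Fixpoint bcost (b : bexp) : nat :=
  match b with
  | WLe e1 e2 => (wcost e1 + wcost e2).+1
  | RLe e1 e2 => (rcost e1 + rcost e2).+1
  | BNot b1 => (bcost b1).+1
  | BAnd b1 b2 => (bcost b1 + bcost b2).+1
  end.

(* [exec B c s s' t]: with words below B, the program c started in s halts in  *)
(* s' after t units of time.                                                   *)
Inductive exec (R : realType) (B : nat) :
    cmd -> state R -> state R -> nat -> Prop :=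
  | exec_skip s : exec B Skip s s 1
  | exec_wset s x e v :
      weval B s e = Some v ->
      exec B (WSet x e) s (set_wvar s x v) (wcost e).+1
  | exec_rset s x e v :
      reval B s e = Some v ->
      exec B (RSet x e) s (set_rvar s x v) (rcost e).+1
  | exec_wput s a e1 e2 i v :
      weval B s e1 = Some i -> weval B s e2 = Some v ->
      exec B (WPut a e1 e2) s (set_warr s a i v) (wcost e1 + wcost e2).+1
  | exec_rput s a e1 e2 i v :
      weval B s e1 = Some i -> reval B s e2 = Some v ->
      exec B (RPut a e1 e2) s (set_rarr s a i v) (wcost e1 + rcost e2).+1
  | exec_seq s1 s2 s3 c1 c2 t1 t2 :
      exec B c1 s1 s2 t1 -> exec B c2 s2 s3 t2 ->
      exec B (Seq c1 c2) s1 s3 (t1 + t2).+1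
  | exec_if s s' b c1 c2 v t :
      beval B s b = Some v -> exec B (if v then c1 else c2) s s' t ->
      exec B (If b c1 c2) s s' (bcost b + t).+1
  | exec_while_stop s b c :
      beval B s b = Some false ->
      exec B (While b c) s s (bcost b).+1
  | exec_while_loop s1 s2 s3 b c t1 t2 :
      beval B s1 b = Some true ->
      exec B c s1 s2 t1 -> exec B (While b c) s2 s3 t2 ->
      exec B (While b c) s1 s3 (bcost b + t1 + t2).+1.

(* Word variable 0 holds n; entry i < n of the real arrays 0, 1, 2, 3 holds    *)
(* the coordinates of the i-th rectangle; everything else is 0.                *)
Definition input (R : realType) (n : nat) (r : 'I_n -> rectangle R) : state R :=
  let coord (f : rectangle R -> R) (i : nat) : R :=
    if insub i is Some j then f (r j) else 0 in
  State (upd (fun=> 0%N) 0%N n) (fun _ _ => 0%N) (fun=> 0)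
    (fun a => match a with
              | 0 => coord (@xmin R)
              | 1 => coord (@xmax R)
              | 2 => coord (@ymin R)
              | 3 => coord (@ymax R)
              | _ => fun=> 0
              end).

(* Parent pointers are read in word array 0: entry i is 0 if i is a root, and  *)
(* j.+1 if j is the parent of i.                                               *)
Definition outputs (R : realType) (n : nat) (s : state R)
    (p : 'I_n -> option 'I_n) : Prop :=
  forall i : 'I_n, warr s 0%N i = if p i is Some j then j.+1 else 0%N.

(* Main.v *)
(* Sweep a vertical line over the plane.  Two rectangles met by the line at a  *)
(* common abscissa are nested as soon as their y-intervals intersect, so when  *)
(* the line reaches the left side of a rectangle g, it suffices to look at the *)
(* endpoint that precedes the lower endpoint of g among the y-endpoints of the *)
(* rectangles currently met: if it is the lower endpoint of h, then h is the   *)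
(* parent of g; if it is the upper endpoint of h, then g and h have the same   *)
(* parent; if there is none, then g is a root.  Closed rectangles may share    *)
(* endpoints; ties are broken by the perimeter so that the endpoints of nested *)
(* rectangles are nested like parentheses.  Endpoints are sorted by a          *)
(* tournament tree, and the same tree, with the y-ranks as positions, answers  *)
(* predecessor queries as prefix maxima.                                       *)

Require Import Defs.
From mathcomp Require Import all_boot all_order all_algebra.
From mathcomp Require Import boolp classical_sets reals topology normedtype.
From mathcomp Require Import landau exp.
From mathcomp Require Import zify ring lra.
Set Implicit Arguments.
Unset Strict Implicit.
Unset Printing Implicit Defensive.
Import Order.TTheory GRing.Theory Num.Theory.
Import numFieldNormedType.Exports.
Local Open Scope classical_set_scope.
Local Open Scope ring_scope.

(** When the sweep line reaches the left side of [g], it meets every rectangle that contains [g].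
    Conversely, if it already meets [h] and the y-interval of [h] contains the lower endpoint of
    [g], then [g] and [h] intersect; by laminarity they are nested, and [h], opened earlier, must be
    the outer one. So the parent of [g] can be read off the endpoint preceding the lower endpoint of
    [g]. If that is the lower endpoint of [h], then [h] is the innermost container, since a smaller
    one would open in between. If it is the upper endpoint of [h], then [h] has the same containers
    as [g], and its parent is known because its left side came earlier. This is
    [parent_from_predecessor], which speaks of ranks only.

    Geometry enters through [sorted_nested_ranks], where the tie-breaking turns inclusion into
    strict nesting of ranks, and through [inside_overlap], where laminarity is used. [parent_forest]
    shows that the least proper containers are the parents of the inclusion forest.

    For the time, the two sorts and the sweep handle 2n endpoints each, with a bounded number of
    tree operations per endpoint, and each operation walks one leaf-to-root path of length O(log n)
    ([run_tree_update], [run_prefix_max]). [run_endpoint_sort] and [run_sweep] add up these costs,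
    [run_forest_program] composes the phases, and [linearithmic_O] bounds the total. *)

(** * Program logic with running times *)

Section ProgramLogic.
Local Open Scope nat_scope.
Variables (R : realType) (B : nat).
Implicit Types (s : state R) (c : cmd) (Q : state R -> Prop).

(** Evaluation is split into a total value and a safety condition, so that values can be computed by
    simplification and overflow is left to arithmetic. *)
Fixpoint wval s (e : wexp) : nat :=
  match e with
  | WLit m => m
  | WVar x => wvar s x
  | WGet a e1 => warr s a (wval s e1)
  | WBin o e1 e2 => word_op_sem o (wval s e1) (wval s e2)
  end.

Fixpoint wsafe s (e : wexp) : Prop :=
  match e with
  | WLit m => m < B
  | WVar _ => True
  | WGet _ e1 => wsafe s e1
  | WBin o e1 e2 =>
      [/\ wsafe s e1, wsafe s e2 & word_op_sem o (wval s e1) (wval s e2) < B]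
  end.

Definition real_op_val (o : real_op) (x y : R) : R :=
  match o with
  | RAdd => x + y | RSub => x - y | RMul => x * y | RDiv => x / y
  end%R.

Fixpoint rval s (e : rexp) : R :=
  match e with
  | RWord e1 => ((wval s e1)%:R)%R
  | RVar x => rvar s x
  | RGet a e1 => rarr s a (wval s e1)
  | RBin o e1 e2 => real_op_val o (rval s e1) (rval s e2)
  end.

Fixpoint rsafe s (e : rexp) : Prop :=
  match e with
  | RVar _ => True
  | RWord e1 | RGet _ e1 => wsafe s e1
  | RBin o e1 e2 =>
      [/\ rsafe s e1, rsafe s e2 & if o is RDiv then rval s e2 <> 0%R else True]
  end.

Fixpoint bval s (b : bexp) : bool :=
  match b with
  | WLe e1 e2 => wval s e1 <= wval s e2
  | RLe e1 e2 => (rval s e1 <= rval s e2)%R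
  | BNot b1 => ~~ bval s b1
  | BAnd b1 b2 => bval s b1 && bval s b2
  end.

Fixpoint bsafe s (b : bexp) : Prop :=
  match b with
  | WLe e1 e2 => wsafe s e1 /\ wsafe s e2
  | RLe e1 e2 => rsafe s e1 /\ rsafe s e2
  | BNot b1 => bsafe s b1
  | BAnd b1 b2 => bsafe s b1 /\ bsafe s b2
  end.

Lemma wevalE s e : wsafe s e -> weval B s e = Some (wval s e).
Proof.
elim: e => [m|x|a e IH|o e1 IH1 e2 IH2] //=; rewrite /word.
- by move=> ->.
- by move=> /IH ->.
- by case=> /IH1 -> /IH2 -> /= ->.
Qed.

Lemma revalE s e : rsafe s e -> reval B s e = Some (rval s e).
Proof.
elim: e => [e|x|a e|o e1 IH1 e2 IH2] //=.
- by move=> /wevalE ->.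
- by move=> /wevalE ->.
- by case=> /IH1 -> /IH2 -> /=; case: o => //= /eqP/negPf ->.
Qed.

Lemma bevalE s b : bsafe s b -> beval B s b = Some (bval s b).
Proof.
elim: b => [e1 e2|e1 e2|b IH|b1 IH1 b2 IH2] /=.
- by case=> /wevalE -> /wevalE ->.
- by case=> /revalE -> /revalE ->.
- by move=> /IH ->.
- by case=> /IH1 -> /IH2 ->.
Qed.

(** Time is only bounded above, so that all paths through a program share one bound. *)
Definition run c s (t : nat) Q :=
  exists s' t', [/\ exec B c s s' t', t' <= t & Q s'].

Fixpoint wp c Q s : Prop :=
  match c with
  | Skip => Q s
  | WSet x e => wsafe s e /\ Q (set_wvar s x (wval s e))
  | RSet x e => rsafe s e /\ Q (set_rvar s x (rval s e))
  | WPut a e1 e2 =>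
      [/\ wsafe s e1, wsafe s e2 & Q (set_warr s a (wval s e1) (wval s e2))]
  | RPut a e1 e2 =>
      [/\ wsafe s e1, rsafe s e2 & Q (set_rarr s a (wval s e1) (rval s e2))]
  | Seq c1 c2 => wp c1 (wp c2 Q) s
  | If b c1 c2 => bsafe s b /\ if bval s b then wp c1 Q s else wp c2 Q s
  | While _ _ => False
  end.

(* The bound on the running time that goes with [wp]; it is meaningless on     *)
(* programs with loops, on which [wp] is [False].                              *)
Fixpoint cost c : nat :=
  match c with
  | Skip => 1
  | WSet _ e => (wcost e).+1
  | RSet _ e => (rcost e).+1
  | WPut _ e1 e2 => (wcost e1 + wcost e2).+1
  | RPut _ e1 e2 => (wcost e1 + rcost e2).+1
  | Seq c1 c2 => (cost c1 + cost c2).+1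
  | If b c1 c2 => (bcost b + (cost c1 + cost c2)).+1
  | While _ _ => 0
  end.

Lemma run_weaken c s t Q Q' t' :
  run c s t Q -> t <= t' -> (forall s', Q s' -> Q' s') -> run c s t' Q'.
Proof.
case=> s' [u [ex le_ut q]] le_tt' QQ'.
by exists s', u; split; [|exact: leq_trans le_tt'|exact: QQ'].
Qed.

Lemma run_seq Q1 c1 c2 s t1 t2 Q :
  run c1 s t1 Q1 -> (forall s', Q1 s' -> run c2 s' t2 Q) ->
  run (Seq c1 c2) s (t1 + t2).+1 Q.
Proof.
case=> s1 [u1 [ex1 le1 q1]] /(_ _ q1) [s2 [u2 [ex2 le2 q2]]].
exists s2, (u1 + u2).+1; split=> //; first exact: exec_seq ex1 ex2.
by rewrite ltnS leq_add.
Qed.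

Lemma run_if b c1 c2 s t Q :
  bsafe s b -> run (if bval s b then c1 else c2) s t Q ->
  run (If b c1 c2) s (bcost b + t).+1 Q.
Proof.
move=> sb [s' [u [ex le_ut q]]]; exists s', (bcost b + u).+1; split=> //.
  exact: exec_if (bevalE sb) ex.
by rewrite ltnS leq_add2l.
Qed.

Lemma wp_run c Q s : wp c Q s -> run c s (cost c) Q.
Proof.
elim: c Q s => [|x e|x e|a e1 e2|a e1 e2|c1 IH1 c2 IH2|b c1 IH1 c2 IH2|b c IH]
  Q s //=.
- by move=> q; exists s, 1; split=> //; exact: exec_skip.
- by case=> /wevalE ev q; do 2 eexists; split; [exact: exec_wset ev| |].
- by case=> /revalE ev q; do 2 eexists; split; [exact: exec_rset ev| |].
- case=> /wevalE ev1 /wevalE ev2 q.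
  by do 2 eexists; split; [exact: exec_wput ev1 ev2| |].
- case=> /wevalE ev1 /revalE ev2 q.
  by do 2 eexists; split; [exact: exec_rput ev1 ev2| |].
- by move=> /IH1 r1; apply: run_seq r1 _ => s'; exact: IH2.
- case=> sb w; apply: run_if => //; case: (bval s b) w => [/IH1|/IH2] r1.
    by apply: run_weaken r1 _ _; [lia|].
  by apply: run_weaken r1 _ _; [lia|].
Qed.

(** The index of the invariant bounds the number of iterations left; it gives termination and the
    cost at once. *)
Lemma run_while (Inv : nat -> state R -> Prop) k b c t Q s :
  (forall j s', Inv j s' -> bsafe s' b /\
     if bval s' b then 0 < j /\ run c s' t (Inv j.-1) else Q s') ->
  Inv k s -> run (While b c) s (k * (bcost b + t).+1 + (bcost b).+1) Q.
Proof.
move=> step; elim: k s => [|k IH] s inv; have [sb] := step _ _ inv.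
  case: ifP => [_ []//|bE q]; exists s, (bcost b).+1; split=> //.
  by apply: exec_while_stop; rewrite bevalE // bE.
case: ifP => [bE [_ [s1 [t1 [ex1 le1 inv1]]]]|bE q].
  have [s2 [t2 [ex2 le2 q2]]] := IH _ inv1.
  exists s2, (bcost b + t1 + t2).+1; split=> //; last by rewrite mulSn; lia.
  by apply: exec_while_loop ex1 ex2; rewrite bevalE // bE.
exists s, (bcost b).+1; split=> //; last by rewrite leq_addl.
by apply: exec_while_stop; rewrite bevalE // bE.
Qed.

Fixpoint wvar_mods c : seq nat :=
  match c with
  | WSet x _ => [:: x]
  | Seq c1 c2 | If _ c1 c2 => wvar_mods c1 ++ wvar_mods c2
  | While _ c1 => wvar_mods c1
  | _ => [::]
  end.

Fixpoint warr_mods c : seq nat :=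
  match c with
  | WPut a _ _ => [:: a]
  | Seq c1 c2 | If _ c1 c2 => warr_mods c1 ++ warr_mods c2
  | While _ c1 => warr_mods c1
  | _ => [::]
  end.

Fixpoint rarr_mods c : seq nat :=
  match c with
  | RPut a _ _ => [:: a]
  | Seq c1 c2 | If _ c1 c2 => rarr_mods c1 ++ rarr_mods c2
  | While _ c1 => rarr_mods c1
  | _ => [::]
  end.

Definition frame c s s' :=
  [/\ forall x, x \notin wvar_mods c -> wvar s' x = wvar s x,
      forall a, a \notin warr_mods c -> warr s' a = warr s a &
      forall a, a \notin rarr_mods c -> rarr s' a = rarr s a].

Lemma exec_frame c s s' t : exec B c s s' t -> frame c s s'.
Proof.
rewrite /frame; elim=> {c s s' t} //=.
- move=> s x e v _; split=> // y; rewrite inE /upd; exact: ifN.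
- move=> s a e1 e2 i v _ _; split=> // y; rewrite inE /upd; exact: ifN.
- move=> s a e1 e2 i v _ _; split=> // y; rewrite inE /upd; exact: ifN.
- move=> s1 s2 s3 c1 c2 t1 t2 _ [w1 a1 r1] _ [w2 a2 r2].
  by split=> x; rewrite mem_cat negb_or => /andP[h1 h2];
    rewrite (w2, a2, r2) // (w1, a1, r1).
- move=> s s' b c1 c2 v t _ _ [w a r].
  by split=> x; rewrite mem_cat negb_or => /andP[h1 h2];
    rewrite (w, a, r) //; case: (v).
- move=> s1 s2 s3 b c t1 t2 _ _ [w1 a1 r1] _ [w2 a2 r2].
  by split=> x h; rewrite (w2, a2, r2) // (w1, a1, r1).
Qed.

Lemma run_frame c s t Q :
  run c s t Q -> run c s t (fun s' => Q s' /\ frame c s s').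
Proof.
by case=> s' [u [ex le_ut q]]; exists s', u; split=> //; split=> //;
  exact: exec_frame ex.
Qed.

End ProgramLogic.

(** * Tournament trees *)

Section TournamentTree.
Local Open Scope nat_scope.
Variable le : rel nat.

Definition best (a b : nat) := if le a b then b else a.

(* Node v has children 2v and 2v+1, the root is 1, and the leaf of position u  *)
(* is 2^m + u.                                                                 *)
Definition tournament (m : nat) (t : nat -> nat) :=
  forall v, 0 < v < 2 ^ m -> t v = best (t v.*2) (t v.*2.+1).

Definition tree_of (m : nat) (t : nat -> nat) (S : pred nat) :=
  tournament m t /\ forall u, u < 2 ^ m -> t (2 ^ m + u) = if S u then u else 0.

Hypotheses (le_refl : reflexive le) (le_trans : transitive le).
Hypothesis le_total : total le.

Lemma best_l a b : le a (best a b).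
Proof. by rewrite /best; case: ifP. Qed.

Lemma best_r a b : le b (best a b).
Proof.
by rewrite /best; case: ifP => // ab; have := le_total a b; rewrite ab.
Qed.

Lemma best_or a b : best a b = a \/ best a b = b.
Proof. by rewrite /best; case: ifP; [right|left]. Qed.

Section Node.
Variables (m : nat) (t : nat -> nat).
Hypothesis tt : tournament m t.

(** Moving to the parent never worsens the content, and [x %/ 2 ^ j] is the ancestor of the leaf [x]
    after [j] moves. *)
Lemma tournament_le j x : j <= m -> 2 ^ m <= x < 2 ^ m.+1 ->
  le (t x) (t (x %/ 2 ^ j)).
Proof.
elim: j => [|j IH] lejm xb; first by rewrite expn0 divn1.
apply: le_trans (IH (ltnW lejm) xb) _.
have vlt : x %/ 2 ^ j.+1 < 2 ^ m.
  rewrite ltn_divLR ?expn_gt0 // -expnD (leq_trans (proj2 (andP xb))) //.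
  by rewrite leq_exp2l //; lia.
have vgt : 0 < x %/ 2 ^ j.+1.
  by rewrite divn_gt0 ?expn_gt0 // (leq_trans _ (proj1 (andP xb))) // leq_exp2l.
rewrite [t (x %/ 2 ^ j.+1)]tt ?vgt // expnSr divnMA.
set w := x %/ 2 ^ j.
have [->|->] : w = (w %/ 2).*2 \/ w = (w %/ 2).*2.+1 by lia.
  by rewrite (_ : (_.*2 %/ 2).*2 = (w %/ 2).*2) ?best_l //; lia.
by rewrite (_ : (_.*2.+1 %/ 2).*2 = (w %/ 2).*2) ?best_r //; lia.
Qed.

(** Descend from [v] to a child with the same content until a leaf is reached; the hypothesis says
    that [v] has height [j]. *)
Lemma tournament_leaf j v : j <= m -> 2 ^ m <= v * 2 ^ j < 2 ^ m.+1 ->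
  exists x, [/\ 2 ^ m <= x < 2 ^ m.+1, x %/ 2 ^ j = v & t v = t x].
Proof.
elim: j v => [|j IH] v lejm; first by rewrite muln1 => vb; exists v; rewrite divn1.
have p2 : 0 < 2 ^ j by rewrite expn_gt0.
rewrite expnS mulnCA => vb.
have vlt : v < 2 ^ m by move: vb; have := leq_pmulr v p2; rewrite expnS; lia.
have vgt : 0 < v by case: v vb {vlt} => //; rewrite mul0n muln0 leqn0 expn_eq0.
(* Cancelling [2 ^ j] leaves even bounds, so that the right child respects the strict one. *)
have pm : 2 ^ m = 2 ^ j * (2 ^ (m - j.+1) * 2).
  by rewrite -[X in _ * (_ * X)]expn1 -!expnD; congr (_ ^ _); lia.
have [c [cb cv ->]] : exists c,
    [/\ 2 ^ m <= c * 2 ^ j < 2 ^ m.+1, c %/ 2 = v & t v = t c].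
  have [E|E] := best_or (t v.*2) (t v.*2.+1).
    exists v.*2; rewrite [t v]tt ?vgt // E; split=> //; last lia.
    by move: vb; rewrite -muln2; lia.
  exists v.*2.+1; rewrite [t v]tt ?vgt // E; split=> //; last lia.
  move: vb; rewrite expnS pm; set q := 2 ^ (m - j.+1) * 2.
  rewrite (mulnC v) mulnCA (mulnCA 2 _ q) (mulnC v.*2.+1).
  rewrite !leq_pmul2l // !ltn_pmul2l //.
  lia.
have [x [xb xc ->]] := IH c (ltnW lejm) cb.
by exists x; rewrite (mulnC 2) divnMA xc cv.
Qed.

End Node.

End TournamentTree.

(* Tree programs: update of a leaf and prefix maximum *)
Declare Scope prog_scope.
Notation "c1 ';;' c2" := (Seq c1 c2)
  (at level 100, right associativity) : prog_scope.
Notation "# m" := (WLit m) (at level 1, format "# m") : prog_scope.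
Notation "$ x" := (WVar x) (at level 1, format "$ x") : prog_scope.
Notation "a .[ e ]" := (WGet a e) : prog_scope.
Infix "+" := (WBin WAdd) : prog_scope.
Infix "-" := (WBin WSub) : prog_scope.
Infix "*" := (WBin WMul) : prog_scope.
Infix "/" := (WBin WDiv) : prog_scope.
Infix "<=" := WLe : prog_scope.
Delimit Scope prog_scope with prog.

(* Word variables: 0 is n, 1 the number 2^m of leaves of the trees, 2 a node,  *)
(* 3 and 4 the contestants at that node, 5 a position, 6 its new content, 7 is *)
(* 2n, 8 a loop counter, 9 and 10 the node and the result of a query, 11 and   *)
(* 12 events, and 13 tells an insertion from a deletion.                       *)
Definition tree_update (T : nat) (cmp : bexp) : cmd :=
  (WPut T ($1 + $5) $6 ;;
   WSet 2 (($1 + $5) / #2) ;;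
   While (#1 <= $2)
     (WSet 3 T.[#2 * $2] ;;
      WSet 4 T.[#2 * $2 + #1] ;;
      If cmp (WPut T $2 $4) (WPut T $2 $3) ;;
      WSet 2 ($2 / #2)))%prog.

Definition prefix_max (T : nat) : cmd :=
  (WSet 9 ($1 + $5) ;;
   WSet 10 #0 ;;
   While (#2 <= $9)
     (If ($9 <= #2 * ($9 / #2)) Skip
        (If ($10 <= T.[$9 - #1]) (WSet 10 T.[$9 - #1]) Skip) ;;
      WSet 9 ($9 / #2)))%prog.

Section TreeProgram.
Local Open Scope nat_scope.
Variables (R : realType) (B : nat).

(** Writing a leaf breaks the tournament equation at most at its parent. Repairing a node moves the
    possible defect one level up, until it leaves through the root. *)
Lemma run_tree_update (T : nat) (cmp : bexp) (le : rel nat) (m : nat)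
    (s : state R) :
  2 ^ m * 2 + 8 < B -> wvar s 1 = 2 ^ m -> wvar s 5 < 2 ^ m ->
  (forall s', rarr s' = rarr s ->
     bsafe B s' cmp /\ bval s' cmp = le (wvar s' 3) (wvar s' 4)) ->
  tournament le m (warr s T) ->
  run B (tree_update T cmp) s ((bcost cmp + 50) * m.+1) (fun s' =>
    tournament le m (warr s' T) /\
    forall u, u < 2 ^ m -> warr s' T (2 ^ m + u) =
      if u == wvar s 5 then wvar s 6 else warr s T (2 ^ m + u)).
Proof.
move=> hB h1 h5 hcmp tt.
have p2 : 0 < 2 ^ m by rewrite expn_gt0.
pose t0 w := if w == 2 ^ m + wvar s 5 then wvar s 6 else warr s T w.
pose Inv j (s' : state R) := [/\ rarr s' = rarr s, j <= m, wvar s' 2 < 2 ^ j,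
  (forall u, u < 2 ^ m -> warr s' T (2 ^ m + u) = t0 (2 ^ m + u)) &
  forall w, 0 < w < 2 ^ m -> w != wvar s' 2 ->
    warr s' T w = best le (warr s' T w.*2) (warr s' T w.*2.+1)].
apply: run_weaken (fun _ h => h).
  apply: (run_seq (Q1 := fun s' => s' = set_warr s T (2 ^ m + wvar s 5) (wvar s 6))).
    by apply: wp_run; rewrite /= h1; repeat split=> //; lia.
  move=> s1 E1.
  apply: (run_seq (Q1 := Inv m)).
    apply: wp_run; rewrite {s1}E1 /= h1; split; first by repeat split; lia.
    split; rewrite //= /upd /= ?eqxx; first lia.
      by move=> u _; rewrite /t0.
    move=> w wb wn; have N : [/\ w != 2 ^ m + wvar s 5, w.*2 != 2 ^ m + wvar s 5 &
      w.*2.+1 != 2 ^ m + wvar s 5] by split; lia.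
    by case: N => /negPf -> /negPf -> /negPf ->; exact: tt.
  move=> {E1}s1 inv1; apply: (run_while (Inv := Inv)) inv1 => j {}s1 [hr hj h2 hl hn].
  split; first by split=> //=; lia.
  case: ifP => /= [v0|v0]; last first.
    split=> [w wb|u ub]; first by apply: hn => //; lia.
    by rewrite hl // /t0 eqn_add2l.
  have vm : wvar s1 2 < 2 ^ m by apply: leq_trans h2 _; rewrite leq_exp2l.
  have j0 : 0 < j by case: j {hj} h2 => // ; lia.
  split=> //.
  pose s2 := set_wvar (set_wvar s1 3 (warr s1 T (wvar s1 2).*2)) 4
     (warr s1 T (wvar s1 2).*2.+1).
  pose s3 := set_warr s2 T (wvar s1 2) (best le (warr s1 T (wvar s1 2).*2)
     (warr s1 T (wvar s1 2).*2.+1)).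
  apply: (run_seq (Q1 := fun s' => s' = set_wvar s1 3 (warr s1 T (wvar s1 2).*2))).
    by apply: wp_run; rewrite /= mul2n; repeat split=> //; lia.
  move=> _ ->; apply: (run_seq (Q1 := eq^~ s2)).
    by apply: wp_run; rewrite /= /upd /= mul2n addn1; repeat split=> //; lia.
  move=> _ ->; apply: (run_seq (Q1 := eq^~ s3)).
    have [|cs cv] := hcmp s2; first by [].
    by apply: wp_run; split=> //; rewrite cv /s3 /best; case: (le _ _); split.
  move=> _ ->; apply: wp_run; rewrite /s3 /s2 /= /upd /= ?eqxx; split.
    by repeat split; lia.
  split; rewrite //= /upd /= ?eqxx.
  - lia.
  - by case: j h2 j0 {hj} => // j; rewrite expnS /=; lia.
  - by move=> u ub; rewrite ifN ?hl //; lia.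
  - move=> w wb wn; case: (w =P wvar s1 2) => [->|wv].
      have N : ((wvar s1 2).*2 != wvar s1 2) && ((wvar s1 2).*2.+1 != wvar s1 2) by lia.
      by case/andP: N => /negPf -> /negPf ->.
    have N : (w.*2 != wvar s1 2) && (w.*2.+1 != wvar s1 2) by lia.
    by case/andP: N => /negPf -> /negPf ->; apply: hn => //; exact/eqP.
by clear; rewrite /=; lia.
Qed.

(** On the path from the leaf of [q] to the root, the left siblings of the right children cover
    exactly the positions below [q]. *)
Lemma run_prefix_max (T m : nat) (S : pred nat) (s : state R) :
  2 ^ m * 2 + 8 < B -> wvar s 1 = 2 ^ m -> wvar s 5 < 2 ^ m ->
  tree_of leq m (warr s T) S ->
  run B (prefix_max T) s (50 * m.+1) (fun s' =>
    (wvar s' 10 = 0 \/ wvar s' 10 < wvar s 5 /\ S (wvar s' 10)) /\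
    forall u, u < wvar s 5 -> S u -> u <= wvar s' 10).
Proof.
move=> hB h1 h5 [tt lf].
have p2 : 0 < 2 ^ m by rewrite expn_gt0.
set q := wvar s 5 in h5 *.
(* At depth [k], an element below [q] is either accounted for by the result or lies under a node
   strictly left of the current one. *)
pose Inv k (s' : state R) := [/\ k <= m /\ warr s' = warr s,
  wvar s' 9 = (2 ^ m + q) %/ 2 ^ (m - k),
  wvar s' 10 = 0 \/ wvar s' 10 < q /\ S (wvar s' 10) &
  forall u, u < q -> S u ->
    u <= wvar s' 10 \/ (2 ^ m + u) %/ 2 ^ (m - k) < wvar s' 9].
apply: run_weaken (fun _ h => h).
  apply: (run_seq (Q1 := eq^~ (set_wvar s 9 (2 ^ m + q)))).
    by apply: wp_run; rewrite /= h1 /q; repeat split=> //; lia.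
  move=> _ ->; apply: (run_seq (Q1 := Inv m)).
    apply: wp_run; rewrite /= /upd /=; split; first lia.
    split; rewrite //= /upd /= ?subnn ?divn1 //; first by left.
    by move=> u uq _; right; rewrite divn1; lia.
  move=> s1 inv1; apply: (run_while (Inv := Inv)) inv1 => k {}s1 [[km E] h9 h10 hu].
  split; first by split=> //=; lia.
  have pk : 2 ^ m = 2 ^ k * 2 ^ (m - k) by rewrite -expnD subnKC.
  have pmk : 0 < 2 ^ (m - k) by rewrite expn_gt0.
  have pk0 : 0 < 2 ^ k by rewrite expn_gt0.
  have node u : (2 ^ m + u) %/ 2 ^ (m - k) = 2 ^ k + u %/ 2 ^ (m - k).
    by rewrite [in LHS]pk divnMDl.
  have uk u : u < 2 ^ m -> u %/ 2 ^ (m - k) < 2 ^ k by move=> um; rewrite ltn_divLR // -pk.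
  case: ifP => /= [r2|r2]; last first.
    split=> // u uq Su; case: (hu u uq Su) => //; rewrite node.
    by move: (u %/ _) (2 ^ k) pk0 r2; clear; lia.
  have k0 : 0 < k.
    move: (uk q h5) r2; rewrite h9 node; move: (q %/ _) => a; case: (k) => [|//].
    by clear; rewrite expn0; lia.
  split=> //.
  have half u : (2 ^ m + u) %/ 2 ^ (m - k.-1) = (2 ^ m + u) %/ 2 ^ (m - k) %/ 2.
    by rewrite -divnMA -expnSr; congr (_ %/ _ ^ _); lia.
  have r9 : wvar s1 9 < 2 ^ k * 2 
    by rewrite h9 node; move: (q %/ _) (uk q h5); clear; lia.
  have r9m : 2 ^ k <= 2 ^ m by rewrite leq_exp2l.
  have rB : wvar s1 9 + 8 < B by move: r9 r9m hB; clear; lia.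
  move: r2 r9 rB; set r := wvar s1 9 => r2 r9 rB.
  (* An even [r] is a left child and adds nothing; for odd [r] the left sibling is [r - 1]. *)
  pose res := if r <= 2 * (r %/ 2) then wvar s1 10 else
     if wvar s1 10 <= warr s T (r - 1) then warr s T (r - 1) else wvar s1 10.
  apply: (run_seq (Q1 := fun s' =>
      [/\ warr s' = warr s, wvar s' 9 = r & wvar s' 10 = res])).
    apply: wp_run; rewrite /= /res -/r; split.
      by repeat split=> //; move: (r) rB; clear; lia.
    case: ifP => rodd; first by rewrite rodd; split.
    rewrite rodd; split; first by repeat split=> //; move: (r) rB; clear; lia.
    rewrite E; case: ifP => cb; rewrite ?cb; last by split.
    split; first by repeat split=> //; move: (r) rB; clear; lia.
    by split; rewrite /= ?E.
  move=> s2 [E2 e9 e10]; apply: wp_run; rewrite /= e9; split.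
    by repeat split=> //; move: (r) rB; clear; lia.
  split; rewrite //= /upd /=.
  - by split=> //; move: km; clear; lia.
  - by rewrite /r h9 half.
  - rewrite e10 /res; case: ifP => // rodd; case: ifP => // _.
    have lb : 2 ^ k <= r by rewrite /r h9 node leq_addr.
    have rodd' : 2 ^ k <= r - 1.
      by case: (k) k0 lb => // k'; move: (r) rodd; clear; rewrite expnS; lia.
    have [||x [xb xv ->]] := @tournament_leaf leq m (warr s T) tt (m - k) (r - 1).
    + by rewrite leq_subr.
    + rewrite expnS pk (mulnA 2) leq_pmul2r // ltn_pmul2r // rodd'.
      by move: r9 r2; clear; lia.
    rewrite (_ : x = 2 ^ m + (x - 2 ^ m)) ?lf; last 2 first.
    + by move: xb; clear; rewrite expnS; lia.
    + by move: xb; clear; rewrite expnS; lia.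
    case: ifP => [Sx|_]; [right; split=> //|by left].
    rewrite ltnNge; apply/negP => qx.
    have : (2 ^ m + q) %/ 2 ^ (m - k) <= x %/ 2 ^ (m - k).
      by apply: leq_div2r; move: xb qx; clear; lia.
    by rewrite -h9 xv -/r; move: r2; clear; lia.
  - move=> u uq Su; rewrite half e10.
    have [ur|] := hu u uq Su.
      by left; rewrite /res; case: ifP => // _; case: ifP => //; move: ur; clear; lia.
    have um := ltn_trans uq h5.
    rewrite -/r /res; set a := _ %/ 2 ^ (m - k) => ur.
    case: ifP => rodd; first by right; move: ur rodd; clear; lia.
    have [eu|nu] := eqVneq a (r - 1); last by right; move: ur nu rodd; clear; lia.
    left; have := @tournament_le leq leqnn leq_trans leq_total m (warr s T) tt
      (m - k) (2 ^ m + u).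
    rewrite -/a eu lf // Su leq_subr => /(_ isT).
    have -> : 2 ^ m <= 2 ^ m + u < 2 ^ m.+1 by move: um; clear; rewrite expnS; lia.
    move=> /(_ isT) H; case: ifP => // /negbT; rewrite -ltnNge => H'.
    exact: leq_trans H (ltnW H').
by clear; rewrite /=; lia.
Qed.

End TreeProgram.

(** * Correctness of the predecessor rule, in terms of ranks *)

Section SweepCorrectness.
Local Open Scope nat_scope.

Definition ranking (M : nat) (O rk : nat -> nat) :=
  (forall p, 0 < p <= M -> 0 < O p <= M /\ rk (O p) = p) /\
  (forall e, 0 < e <= M -> 0 < rk e <= M /\ O (rk e) = e).

Variables (n : nat) (X Y YO : nat -> nat) (inside : rel nat).

(* Rectangles are numbered from 1 to n; event g is the lower endpoint of g and *)
(* event n + g its upper endpoint.                                             *)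
Definition owner (f : nat) := if f <= n then f else f - n.
(** The line meets [g] just before it processes the event of x-rank [p]. *)
Definition active (p g : nat) := X g < p <= X (n + g).
Definition active_rank (p w : nat) :=
  (0 < w <= n + n) && active p (owner (YO w)).

Definition is_parent (g o : nat) :=
  if o is 0 then forall h, 0 < h <= n -> ~~ inside g h
  else [/\ 0 < o <= n, inside g o &
         forall h, 0 < h <= n -> inside g h -> h = o \/ inside o h].

Definition nested_ranks (Z : nat -> nat) :=
  (forall g, 0 < g <= n -> Z g < Z (n + g)) /\
  (forall g h, 0 < g <= n -> 0 < h <= n -> inside g h ->
     Z h < Z g /\ Z (n + g) < Z (n + h)).

Hypotheses (Xnested : nested_ranks X) (Ynested : nested_ranks Y).
Hypothesis overlap : forall g h, 0 < g <= n -> 0 < h <= n -> g != h ->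
  X g <= X (n + h) -> X h <= X (n + g) ->
  Y g <= Y (n + h) -> Y h <= Y (n + g) -> inside g h || inside h g.
Hypothesis Yranking : ranking (n + n) YO Y.

Lemma active_rank_low p g : 0 < g <= n -> active p g -> active_rank p (Y g).
Proof.
move=> gn ag; have [|r e] := Yranking.2 g; first by lia.
rewrite /active_rank /owner e; case: ifP; last by lia.
by rewrite ag andbT; lia.
Qed.

Lemma active_rank_high p g : 0 < g <= n -> active p g ->
  active_rank p (Y (n + g)).
Proof.
move=> gn ag; have [|r e] := Yranking.2 (n + g); first by lia.
rewrite /active_rank /owner e; case: ifP; first by lia.
by rewrite addKn ag andbT; lia.
Qed.

(** Here [res] is the greatest active y-rank below that of [g], so no active endpoint lies strictly
    between them; every case below ends by contradicting this gap or the nesting of ranks. *)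
Lemma parent_from_predecessor (par : nat -> nat) g res : 0 < g <= n ->
  (forall h, 0 < h <= n -> X h < X g -> is_parent h (par h)) ->
  (res = 0 \/ res < Y g /\ active_rank (X g) res) ->
  (forall u, u < Y g -> active_rank (X g) u -> u <= res) ->
  is_parent g (if res == 0 then 0 else
               if YO res <= n then YO res else par (YO res - n)).
Proof.
move=> gn hpar hres hmax.
have act h : 0 < h <= n -> inside g h -> active (X g) h.
  move=> hn gh; have := Xnested.1 g gn; have := Xnested.2 g h gn hn gh.
  by rewrite /active; lia.
(* The ranks overlap, so the rectangles are nested, and [inside h g] would put the left side of [g]
   before that of [h]. *)
have out h : 0 < h <= n -> active (X g) h -> Y h < Y g -> Y g < Y (n + h) -> inside g h.
  move=> hn ah l u; have g1 := Xnested.1 g gn; have g2 := Ynested.1 g gn.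
  have gh : g != h by apply: contraTneq l => ->; rewrite ltnn.
  have := overlap gn hn gh; have := Xnested.2 h g hn gn; move: ah; rewrite /active.
  case: (inside h g) => [ah [] //|ah _]; first by lia.
  by rewrite orbF; apply; lia.
case: eqVneq => [r0|rn0] /=.
  move=> h hn; apply/negP => gh.
  have := hmax (Y h) (Ynested.2 g h gn hn gh).1 (active_rank_low hn (act h hn gh)).
  have [|] := Yranking.2 h; lia.
case: hres => [/eqP|[rlt ra]]; first by rewrite (negPf rn0).
move: (ra); rewrite /active_rank => /andP[rM]; have [fM fY] := Yranking.1 res rM.
set f := YO res in fM fY *; rewrite /owner; case: ifP => fn aj.
  have fn' : 0 < f <= n by lia.
  have gf : inside g f.
    apply: out => //; first by rewrite fY.
    have := hmax (Y (n + f)); have := active_rank_high fn' aj; have := Ynested.1 f fn'.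
    have : Y (n + f) <> Y g.
      move=> e; have [|_] := Yranking.2 g; first lia.
      by have [|_] := Yranking.2 (n + f); rewrite ?e; lia.
    by rewrite fY; lia.
  (* Another container [h] of [g] overlaps [f]; were it inside [f], its lower endpoint would fall in
     the gap. *)
  rewrite /is_parent; case E: f => [|f']; first by lia.
  rewrite -E; split=> // h hn gh; case: (eqVneq h f) => [|hf]; [by left|right].
  have := overlap hn fn' hf.
  have := Xnested.2 g h gn hn gh; have := Xnested.2 g f gn fn' gf.
  have := Ynested.2 g h gn hn gh; have := Ynested.2 g f gn fn' gf.
  have := Xnested.1 g gn; have := Ynested.1 g gn.
  have := Ynested.2 h f hn fn'.
  have := hmax (Y h) (Ynested.2 g h gn hn gh).1 (active_rank_low hn (act h hn gh)).
  case: (inside f h) => //; case: (inside h f); last by rewrite /=; lia.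
  by rewrite -fY; move=> ? /(_ isT); lia.
set j := f - n in aj *.
have jn : 0 < j <= n by lia.
have fj : f = n + j by lia.
(* A container of one of [g], [j] cannot close between the upper endpoint of [j] and the lower
   endpoint of [g], nor open there. *)
have same h : 0 < h <= n -> inside g h = inside j h.
  move=> hn; apply/idP/idP => ih.
    have ah := act h hn ih; have jh : h != j.
      apply/eqP => hj; have := Ynested.2 g h gn hn ih; have := Ynested.1 g gn.
      by rewrite hj -fj fY; lia.
    have := overlap hn jn jh; have := Ynested.2 g h gn hn ih; have := Ynested.1 g gn.
    have := hmax (Y h) (Ynested.2 g h gn hn ih).1 (active_rank_low hn ah).
    have := Ynested.2 h j hn jn; have := Ynested.1 j jn.
    move: ah aj; rewrite /active -fj fY; case: (inside j h) => //.
    case: (inside h j); last by rewrite /=; lia.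
    by move=> ? ? ? /(_ isT); lia.
  have := Xnested.2 j h jn hn ih; have := Ynested.2 j h jn hn ih => Yjh Xjh.
  have ah : active (X g) h by move: aj; rewrite /active; lia.
  have := hmax (Y (n + h)); have := active_rank_high hn ah => arh /(_ _ arh) hm.
  apply: out => //; first by have := Ynested.1 j jn; move: Yjh; rewrite -fj fY; lia.
  have : Y (n + h) <> Y g.
    move=> e; have [|_] := Yranking.2 g; first lia.
    by have [|_] := Yranking.2 (n + h); rewrite ?e; lia.
  by move: Yjh hm; rewrite -fj fY; lia.
have := hpar j jn; case: (par j) => [|o]; rewrite /is_parent.
  by move=> H h hn; rewrite same //; apply: H => //; move: aj; rewrite /active; lia.
case=> [|on jo H]; first by move: aj; rewrite /active; lia.
by rewrite same //; split=> // h hn; rewrite same //; exact: H.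
Qed.

End SweepCorrectness.

(** * From coordinates to ranks, and from parents to the forest *)

Section Geometry.
Variable R : realType.

Definition key_le (K1 K2 : nat -> R) : rel nat := fun e f =>
  (K1 e < K1 f) || (K1 e <= K1 f) && (K2 e <= K2 f).

Lemma key_le_refl K1 K2 : reflexive (key_le K1 K2).
Proof. by move=> e; rewrite /key_le !lexx orbT. Qed.

Lemma key_le_trans K1 K2 : transitive (key_le K1 K2).
Proof.
move=> f e g; rewrite /key_le => /orP[l1|/andP[l1 l2]] /orP[l3|/andP[l3 l4]].
- by rewrite (lt_trans l1 l3).
- by rewrite (lt_le_trans l1 l3).
- by rewrite (le_lt_trans l1 l3).
- by rewrite (le_trans l1 l3) (le_trans l2 l4) orbT.
Qed.

Lemma key_le_total K1 K2 : total (key_le K1 K2).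
Proof.
move=> e f; rewrite /key_le; case: (ltgtP (K1 e) (K1 f)) => //= _.
exact: le_total.
Qed.

Definition inside (c : nat -> nat -> R) : rel nat := fun g h =>
  [&& g != h, c 0%N h.-1 <= c 0%N g.-1, c 1%N g.-1 <= c 1%N h.-1,
      c 2%N h.-1 <= c 2%N g.-1 & c 3%N g.-1 <= c 3%N h.-1].

(* One more than the half perimeter, so that it is positive even on points.    *)
Definition girth (c : nat -> nat -> R) (g : nat) : R :=
  (c 1%N g.-1 - c 0%N g.-1) + (c 3%N g.-1 - c 2%N g.-1) + 1.

(* The keys of the 2n endpoints in the direction whose coordinates are lo and  *)
(* hi.  Endpoints at the same place are compared by the signed girth: an outer *)
(* rectangle opens before and closes after an inner one, and all rectangles    *)
(* open before any closes.                                                     *)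
Definition is_key (n : nat) (c : nat -> nat -> R) (lo hi : nat)
    (K1 K2 : nat -> R) :=
  forall g, (0 < g <= n)%N ->
  [/\ K1 g = c lo g.-1, K1 (n + g)%N = c hi g.-1,
      K2 g = - girth c g & K2 (n + g)%N = girth c g].

Section Family.
Variables (n : nat) (r : 'I_n -> rectangle R).
Hypothesis region_inj : injective (fun i => region (r i)).
Hypothesis region_laminar : laminar (range (fun i => region (r i))).

Let c := rarr (input r).

Lemma inputE (i : 'I_n) : [/\ c 0 i = xmin (r i), c 1 i = xmax (r i),
  c 2 i = ymin (r i) & c 3 i = ymax (r i)].
Proof. by rewrite /c /= !valK. Qed.

Lemma region_sub (i j : 'I_n) : region (r i) `<=` region (r j) <->
  [&& c 0%N j <= c 0%N i, c 1%N i <= c 1%N j,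
      c 2%N j <= c 2%N i & c 3%N i <= c 3%N j].
Proof.
have [-> -> -> ->] := inputE i; have [-> -> -> ->] := inputE j.
have xi := xmin_le_xmax (r i); have yi := ymin_le_ymax (r i); split.
  move=> sub.
  have [/= /andP[a _] /andP[b _]] : region (r j) (xmin (r i), ymin (r i)).
    by apply: sub; split; rewrite /= lexx.
  have [/= /andP[_ d] /andP[_ e]] : region (r j) (xmax (r i), ymax (r i)).
    by apply: sub; split; rewrite /= lexx andbT.
  by apply/and4P; split.
move=> /and4P[h1 h2 h3 h4] z [/andP[a b] /andP[d e]]; split; apply/andP; split.
- exact: le_trans h1 a.
- exact: le_trans b h2.
- exact: le_trans h3 d.
- exact: le_trans e h4.
Qed.

Lemma inside_sub (i j : 'I_n) :
  inside c i.+1 j.+1 <-> i <> j /\ region (r i) `<=` region (r j).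
Proof.
rewrite /inside eqSS /=; split=> [/andP[ij] /region_sub s|[ij /region_sub s]].
  by split=> //; apply/eqP.
by rewrite s andbT; apply/eqP => /val_inj.
Qed.

Lemma girth_ge1 g : (0 < g <= n)%N -> 1 <= girth c g.
Proof.
case: g => // g gn; have [e0 e1 e2 e3] := inputE (Ordinal gn).
rewrite /girth /= in e0 e1 e2 e3 *; rewrite e0 e1 e2 e3.
by rewrite lerDr addr_ge0 // subr_ge0 ?xmin_le_xmax ?ymin_le_ymax.
Qed.

(** Without strictness all four coordinates would agree, against the injectivity of the family. *)
Lemma girth_inside g h : (0 < g <= n)%N -> (0 < h <= n)%N -> inside c g h ->
  girth c g < girth c h.
Proof.
case: g h => [//|g] [//|h] gn hn /and5P[gh h0 h1 h2 h3]; rewrite ltNge /girth /=.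
rewrite /= in h0 h1 h2 h3; apply/negP => l.
have {}l : (c 1%N h - c 0%N h) + (c 3%N h - c 2%N h) <=
           (c 1%N g - c 0%N g) + (c 3%N g - c 2%N g) by lra.
pose i := Ordinal gn; pose j := Ordinal hn.
suff ij : i = j by move: gh; rewrite -[g]/(val i) ij eqxx.
apply: region_inj; apply/seteqP; split; apply/region_sub => /=;
  apply/and4P; split; lra.
Qed.

(** Coordinates give weak inequalities. Ties are strict in the second key: the girth is positive, so
    lower endpoints precede upper ones, and it is larger for the outer rectangle. *)
Lemma sorted_nested_ranks lo hi K1 K2 (Z : nat -> nat) :
  is_key n c lo hi K1 K2 ->
  (forall g, (0 < g <= n)%N -> c lo g.-1 <= c hi g.-1) ->
  (forall g h, inside c g h -> c lo h.-1 <= c lo g.-1 /\ c hi g.-1 <= c hi h.-1) ->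
  (forall e f, (0 < e <= n + n)%N -> (0 < f <= n + n)%N -> (Z e <= Z f)%N ->
     key_le K1 K2 e f) ->
  nested_ranks n (inside c) Z.
Proof.
move=> key lohi ins srt; split=> [g gn|g h gn hn gh].
  have [k1 k2 k3 k4] := key g gn; have := girth_ge1 gn; have := lohi g gn.
  rewrite ltnNge => l1 l2; apply/negP => l.
  have : key_le K1 K2 (n + g) g by apply: srt => //; lia.
  by rewrite /key_le k1 k2 k3 k4 => /orP[|/andP[]]; lra.
have [k1 k2 k3 k4] := key g gn; have [k5 k6 k7 k8] := key h hn.
have l1 := girth_inside gn hn gh; have [l2 l3] := ins _ _ gh.
split; rewrite ltnNge; apply/negP => l.
  have : key_le K1 K2 g h by apply: srt => //; lia.
  by rewrite /key_le k1 k3 k5 k7 => /orP[|/andP[]]; lra.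
have : key_le K1 K2 (n + h) (n + g) by apply: srt => //; lia.
by rewrite /key_le k2 k4 k6 k8 => /orP[|/andP[]]; lra.
Qed.

Lemma inside_overlap K2 KX KY (X Y : nat -> nat) :
  is_key n c 0 1 KX K2 -> is_key n c 2 3 KY K2 ->
  (forall e f, (0 < e <= n + n)%N -> (0 < f <= n + n)%N -> (X e <= X f)%N ->
     key_le KX K2 e f) ->
  (forall e f, (0 < e <= n + n)%N -> (0 < f <= n + n)%N -> (Y e <= Y f)%N ->
     key_le KY K2 e f) ->
  forall g h, (0 < g <= n)%N -> (0 < h <= n)%N -> g != h ->
  (X g <= X (n + h))%N -> (X h <= X (n + g))%N ->
  (Y g <= Y (n + h))%N -> (Y h <= Y (n + g))%N ->
  inside c g h || inside c h g.
Proof.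
move=> keyX keyY srtX srtY g h gn hn gh xgh xhg ygh yhg.
have le1 K e f : key_le K K2 e f -> K e <= K f.
  by case/orP => [/ltW//|/andP[]].
have {}xgh : KX g <= KX (n + h)%N by apply/le1/srtX => //; lia.
have {}xhg : KX h <= KX (n + g)%N by apply/le1/srtX => //; lia.
have {}ygh : KY g <= KY (n + h)%N by apply/le1/srtY => //; lia.
have {}yhg : KY h <= KY (n + g)%N by apply/le1/srtY => //; lia.
have [kg1 kg2 _ _] := keyX g gn; have [kg3 kg4 _ _] := keyY g gn.
have [kh1 kh2 _ _] := keyX h hn; have [kh3 kh4 _ _] := keyY h hn.
rewrite ?kg1 ?kg2 ?kg3 ?kg4 ?kh1 ?kh2 ?kh3 ?kh4 in xgh xhg ygh yhg.
case: g h gn hn gh xgh xhg ygh yhg {kg1 kg2 kg3 kg4 kh1 kh2 kh3 kh4} =>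
  [//|g] [//|h] gn hn gh /= xgh xhg ygh yhg.
pose i := Ordinal gn; pose j := Ordinal hn.
have ij : i <> j by move=> /(congr1 val) /= e; rewrite e eqxx in gh.
have [gi0 gi1 gi2 gi3] := inputE i; have [gj0 gj1 gj2 gj3] := inputE j.
rewrite /= in gi0 gi1 gi2 gi3 gj0 gj1 gj2 gj3.
rewrite gi0 gi1 gi2 gi3 gj0 gj1 gj2 gj3 in xgh xhg ygh yhg.
have := xmin_le_xmax (r i); have := ymin_le_ymax (r i).
have := xmin_le_xmax (r j); have := ymin_le_ymax (r j) => yj xj yi xi.
have [] := region_laminar (X := region (r i)) (Y := region (r j)).
- by exists i.
- by exists j.
(* Two overlapping rectangles share the lower left corner of their intersection. *)
- move=> /seteqP[/(_ (Num.max (xmin (r i)) (xmin (r j)),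
                      Num.max (ymin (r i)) (ymin (r j)))) + _].
  by case; split; split; rewrite /= ge_max !le_max ?lexx ?orbT /=; apply/andP.
- case=> s; apply/orP; [left|right].
    exact: (proj2 (inside_sub i j)).
  by apply: (proj2 (inside_sub j i)); split=> // /esym.
Qed.

Definition parent_of (w : nat -> nat) (i : 'I_n) : option 'I_n :=
  if w i is o.+1 then insub o else None.

(** A container has a smaller rank [Z], so climbing stops. A proper container of [j] is the parent
    of [j] or contains it, so climbing reaches it. *)
Lemma parent_forest (w Z : nat -> nat) :
  nested_ranks n (inside c) Z ->
  (forall g, (0 < g <= n)%N -> is_parent n (inside c) g (w g.-1)) ->
  (forall i : 'I_n, w i = if parent_of w i is Some j then j.+1 else 0%N) /\
  inclusion_forest (fun i => region (r i)) (parent_of w).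
Proof.
move=> [_ Zn] par.
have parP (i : 'I_n) : (w i = 0%N /\ parent_of w i = None /\
      forall h : 'I_n, ~~ inside c i.+1 h.+1) \/
    exists o : 'I_n, [/\ w i = o.+1, parent_of w i = Some o, inside c i.+1 o.+1 &
      forall h : 'I_n, inside c i.+1 h.+1 -> h = o \/ inside c o.+1 h.+1].
  have := par i.+1 (ltn_ord i); rewrite /parent_of /=.
  case: (w i) => [|o] /=.
    by move=> H; left; split=> //; split=> // h; exact: (H h.+1 (ltn_ord h)).
  case=> on io H; right; exists (Ordinal on); split=> //; first by rewrite insubT.
  by move=> h /(H h.+1 (ltn_ord h)) [[e]|]; [left; exact: val_inj|right].
split=> [i|].
  by case: (parP i) => [[-> [-> _]] | [q [-> -> _ _]]].
have upS k i : up (parent_of w) k.+1 i = obind (up (parent_of w) k) (parent_of w i).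
  rewrite /up iterSr /=; case: (parent_of w i) => //=.
  by elim: k => //= k ->.
have ind (P : 'I_n -> Prop) :
    (forall i : 'I_n, (forall o : 'I_n, inside c i.+1 o.+1 -> P o) -> P i) ->
    forall i, P i.
  move=> step i; have [k] := ubnP (Z i.+1); elim: k i => // k IH i ik.
  apply: step => o io; apply: IH.
  by have := (Zn i.+1 o.+1 (ltn_ord i) (ltn_ord o) io).1; lia.
split.
  elim/ind => i IH; case: (parP i) => [[_ [e _]] | [q [_ e io _]]].
    by exists 1%N; rewrite upS e.
  by have [k ek] := IH q io; exists k.+1; rewrite upS e.
move=> i j; split.
  case=> k; elim: k j => [|k IH] j; first by case=> ->.
  rewrite upS; case: (parP j) => [[_ [-> _]] | [q [_ -> jo _]]] //= /IH s.
  by apply: subset_trans s; have [] := (inside_sub j q).1 jo.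
elim/ind: j => j IH sub; have [->|ij] := pselect (i = j); first by exists 0%N.
have ji : inside c j.+1 i.+1 by apply/inside_sub; split=> // /esym.
case: (parP j) => [[_ [_ H]] | [q [_ e jo H]]]; first by rewrite (negPf (H i)) in ji.
have [->|oi] := H i ji; first by exists 1%N; rewrite upS e.
have [|k ek] := IH q jo; first by have [] := (inside_sub q i).1 oi.
by exists k.+1; rewrite upS e.
Qed.

End Family.
End Geometry.

(** * Sorting the endpoints *)

(* Position 0 encodes an empty leaf, hence loses against every endpoint; among *)
(* endpoints the one with the smaller key wins.                                *)
Definition sort_le (R : realType) (K1 K2 : nat -> R) : rel nat := fun a b =>
  (a == 0%N) || (0 < b)%N && key_le K1 K2 b a.

(** Disjunctions are written by De Morgan, and the strict comparison of keys as a negated [RLe]. *)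
Definition sort_cmp (K : nat) : bexp :=
  (BNot (BAnd (BNot ($3 <= #0))
    (BNot (BAnd (#1 <= $4)
      (BNot (BAnd (RLe (RGet K $3) (RGet K $4))
        (BNot (BAnd (RLe (RGet K $4) (RGet K $3))
                    (RLe (RGet 6 $4) (RGet 6 $3))))))))))%prog.

Definition tree_fill (K T : nat) : cmd :=
  (WSet 8 #1 ;;
   While ($8 <= $7)
     (WSet 5 $8 ;; WSet 6 $8 ;; tree_update T (sort_cmp K) ;;
      WSet 8 ($8 + #1)))%prog.

Definition tree_drain (K T O Q : nat) : cmd :=
  (WSet 8 #1 ;;
   While ($8 <= $7)
     ((WSet 11 T.[#1] ;; WPut O $8 $11 ;; WPut Q $11 $8 ;;
       WSet 5 $11 ;; WSet 6 #0) ;;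
      tree_update T (sort_cmp K) ;;
      WSet 8 ($8 + #1)))%prog.

Definition endpoint_sort (K T O Q : nat) : cmd :=
  Seq (tree_fill K T) (tree_drain K T O Q).

Section EndpointSort.
Local Open Scope nat_scope.
Variables (R : realType) (B m : nat).
Hypothesis hB : 2 ^ m * 2 + 8 < B.

Lemma sort_le_refl (K1 K2 : nat -> R) : reflexive (sort_le K1 K2).
Proof. by move=> [|e]; rewrite /sort_le //= key_le_refl. Qed.

Lemma sort_le_trans (K1 K2 : nat -> R) : transitive (sort_le K1 K2).
Proof.
move=> b a d; rewrite /sort_le; case: (eqVneq a 0) => //= a0.
move=> /andP[b0 ba]; rewrite -[b == 0]negbK -lt0n b0 /= => /andP[-> db].
exact: key_le_trans db ba.
Qed.

Lemma sort_le_total (K1 K2 : nat -> R) : total (sort_le K1 K2).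
Proof. by move=> [|a] [|b]; rewrite /sort_le //= key_le_total. Qed.

Lemma sort_cmpP (s : state R) K : bsafe B s (sort_cmp K) /\
  bval s (sort_cmp K) = sort_le (rarr s K) (rarr s 6) (wvar s 3) (wvar s 4).
Proof.
split; first by rewrite /=; repeat split=> //; lia.
rewrite /= /sort_le /key_le negb_and !negbK leqn0; congr (_ || (_ && _)).
by rewrite negb_and negbK -ltNge.
Qed.

Lemma eq_tree_of le t (S S' : pred nat) : S =1 S' -> tree_of le m t S ->
  tree_of le m t S'.
Proof. by move=> e [tt lf]; split=> // u um; rewrite lf // e. Qed.

Lemma tree_of_pred0 (le : rel nat) t : (forall i, t i = 0) -> tree_of le m t pred0.
Proof. by move=> t0; split=> [v _|u _]; rewrite /best !t0 ?if_same. Qed.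

Lemma run_tree_set (T : nat) cmp (le : rel nat) (S : pred nat) (b : bool)
    (s : state R) :
  wvar s 1 = 2 ^ m -> wvar s 5 < 2 ^ m ->
  wvar s 6 = (if b then wvar s 5 else 0) ->
  (forall s', rarr s' = rarr s ->
     bsafe B s' cmp /\ bval s' cmp = le (wvar s' 3) (wvar s' 4)) ->
  tree_of le m (warr s T) S ->
  run B (tree_update T cmp) s ((bcost cmp + 50) * m.+1) (fun s' =>
    tree_of le m (warr s' T) (fun u => if u == wvar s 5 then b else S u) /\
    frame (tree_update T cmp) s s').
Proof.
move=> h1 h5 h6 hcmp [tt lf].
apply: run_weaken (leqnn _) _; first exact: run_frame (run_tree_update hB h1 h5 hcmp tt).
move=> s' [[tt' lf'] fr]; split=> //; split=> // u um.
by rewrite lf' // h6 lf //; case: (u =P wvar s 5) => // ->.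
Qed.

(** Every leaf lies below node 1. The witness [u] keeps the root from being an empty leaf, as 0
    beats no endpoint. *)
Lemma tree_of_root (le : rel nat) t (S : pred nat) u : reflexive le ->
  transitive le -> total le -> (forall e, 0 < e -> ~~ le e 0) ->
  tree_of le m t S -> 0 < u < 2 ^ m -> S u ->
  [/\ S (t 1), t 1 < 2 ^ m & forall e, e < 2 ^ m -> S e -> le e (t 1)].
Proof.
move=> rf tr tl bot [tt lf] ub Su.
have p2 : 0 < 2 ^ m by rewrite expn_gt0.
have d1 e : e < 2 ^ m -> (2 ^ m + e) %/ 2 ^ m = 1.
  by move=> em; rewrite -{1}[2 ^ m]mul1n divnMDl // divn_small.
have up e : e < 2 ^ m -> S e -> le e (t 1).
  move=> em Se; have := @tournament_le le rf tr tl m t tt m (2 ^ m + e) (leqnn m).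
  by rewrite d1 // lf // Se; apply; rewrite expnS; lia.
have [|x [xb _ E]] := @tournament_leaf le m t tt m 1 (leqnn m).
  by rewrite mul1n expnS; lia.
rewrite expnS in xb; rewrite E in up *.
have xE : x = 2 ^ m + (x - 2 ^ m) by lia.
rewrite xE lf in up *; [|lia].
case: ifP up => [Sx up|_ up]; first by split=> //; lia.
by have := bot u; rewrite up //; lia.
Qed.

Lemma pigeonhole (f : nat -> nat) a b :
  (forall i, 0 < i <= a -> 0 < f i <= b) ->
  (forall i j, 0 < i <= a -> 0 < j <= a -> f i = f j -> i = j) -> a <= b.
Proof.
move=> fb finj; rewrite -(size_iota 1 a) -(size_map f) -(size_iota 1 b).
apply: uniq_leq_size.
  rewrite map_inj_in_uniq ?iota_uniq // => i j; rewrite !mem_iota => ia ja.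
  by apply: finj; lia.
move=> _ /mapP[i + ->]; rewrite !mem_iota => ia; have := fb i; lia.
Qed.

Section Sort.
Variables (K T O Q M : nat) (s : state R).
Hypotheses (OT : O != T) (QT : Q != T) (OQ : O != Q).
Hypotheses (h1 : wvar s 1 = 2 ^ m) (h7 : wvar s 7 = M) (hM : M < 2 ^ m).
Hypotheses (T0 : forall i, warr s T i = 0) (Q0 : forall i, warr s Q i = 0).

Let le := sort_le (rarr s K) (rarr s 6).
Let env (s' : state R) := [/\ rarr s' = rarr s, wvar s' 1 = 2 ^ m & wvar s' 7 = M].

Let cmpP (s' : state R) : rarr s' = rarr s ->
  bsafe B s' (sort_cmp K) /\ bval s' (sort_cmp K) = le (wvar s' 3) (wvar s' 4).
Proof. by move=> e; rewrite /le -e; exact: sort_cmpP. Qed.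

Let frame_env s1 s2 : env s1 -> frame (tree_update T (sort_cmp K)) s1 s2 ->
  [/\ env s2, wvar s2 8 = wvar s1 8, warr s2 O = warr s1 O & warr s2 Q = warr s1 Q].
Proof.
move=> [e1 e2 e3] [fw fa fr]; split.
- split; [|by rewrite fw|by rewrite fw].
  by rewrite -e1; apply: funext => a; rewrite fr.
- by rewrite fw.
- by rewrite fa //= !inE (negPf OT).
- by rewrite fa //= !inE (negPf QT).
Qed.

Lemma run_tree_fill : run B (tree_fill K T) s (200 * M.+1 * m.+1) (fun s' =>
  [/\ env s', tree_of le m (warr s' T) (fun u => 0 < u <= M) &
      warr s' Q = warr s Q]).
Proof.
pose Inv j (s' : state R) := [/\ env s', warr s' Q = warr s Q, 0 < wvar s' 8,
  wvar s' 8 + j = M.+1 & tree_of le m (warr s' T) (fun u => 0 < u < wvar s' 8)].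
apply: run_weaken (fun _ h => h).
  apply: (run_seq (Q1 := Inv M)).
    apply: wp_run; split; first by rewrite /=; lia.
    split; rewrite //=.
    apply: eq_tree_of (tree_of_pred0 _ T0) => u; rewrite /upd /=; lia.
  move=> s2 inv; apply: (run_while (Inv := Inv)) inv => j s3 [en hq i0 ij tr].
  split=> //; have [e1 e2 e3] := en; rewrite /= e3; case: ifP => iM; last first.
    by split=> //; apply: eq_tree_of tr => u; lia.
  split; first lia.
  apply: (run_seq (Q1 := fun s' => s' = set_wvar s3 5 (wvar s3 8))); first exact: wp_run.
  pose s4 := set_wvar (set_wvar s3 5 (wvar s3 8)) 6 (wvar s3 8).
  move=> _ ->; apply: (run_seq (Q1 := fun s' => s' = s4)); first exact: wp_run.
  move=> _ ->.
  apply: run_seq.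
    apply: (@run_tree_set T _ le (fun u => 0 < u < wvar s3 8) true s4) => //.
      by rewrite /s4 /= /upd /=; lia.
    by move=> s' e; apply: cmpP; rewrite e.
  move=> s5 [tr5 fr]; have en4 : env s4 by [].
  have [en5 i5 o5 q5] := frame_env en4 fr.
  apply: wp_run; split; first by rewrite /= i5 /s4 /= /upd /=; repeat split=> //; lia.
  rewrite /= i5 /s4 /= {2}/upd /=.
  split=> //=; rewrite /upd /= ?q5 //=; [lia|lia|].
  apply: eq_tree_of tr5 => u; rewrite /s4 /= /upd /=; case: eqP; lia.
rewrite /=; nia.
Qed.

Definition sorted_ranking (K1 K2 : nat -> R) (O' Q' : nat -> nat) :=
  ranking M O' Q' /\ forall e f, 0 < e <= M -> 0 < f <= M -> Q' e <= Q' f ->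
    key_le K1 K2 e f.

(* Here Q' is 0 on the endpoints that have not been extracted yet.             *)
Let extracted i (O' Q' : nat -> nat) :=
  [/\ forall p, 0 < p < i -> 0 < O' p <= M /\ Q' (O' p) = p,
      forall e, 0 < e <= M -> Q' e < i /\ (Q' e != 0 -> O' (Q' e) = e) &
      forall e f, 0 < e <= M -> 0 < f <= M -> Q' e != 0 -> Q' f = 0 \/ Q' e <= Q' f ->
        key_le (rarr s K) (rarr s 6) e f].

(** Otherwise [Q'] would inject the [M] endpoints into the [i - 1] ranks given so far. *)
Lemma extracted_lt i O' Q' : 0 < i <= M -> extracted i O' Q' ->
  exists2 e, 0 < e <= M & Q' e = 0.
Proof.
move=> iM [h h' _]; apply: contrapT => none.
have nz e : 0 < e <= M -> Q' e != 0.
  by move=> eM; apply/eqP => e0; apply: none; exists e.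
have : M <= i.-1.
  apply: (@pigeonhole Q') => [e eM|e f eM fM E].
    by have := nz e eM; have := h' e eM; lia.
  by have [_ <-] := h' e eM; rewrite ?nz // E; have [_ ->] := h' f fM; rewrite ?nz.
lia.
Qed.

Lemma extracted_all O' Q' : extracted M.+1 O' Q' ->
  sorted_ranking (rarr s K) (rarr s 6) O' Q'.
Proof.
move=> [h h' h3]; have nz e : 0 < e <= M -> Q' e != 0.
  move=> eM; apply/eqP => e0.
  suff : M.+1 <= M by rewrite ltnn.
  (* A missing endpoint [e], added to the [M] listed ones, would make [M + 1] distinct endpoints. *)
  apply: (@pigeonhole (fun p => if p == M.+1 then e else O' p)) => [p pM|p q pM qM].
    by case: eqP => // pn; have [] := h p; lia.
  case: eqP => [->|pn]; case: eqP => [->|qn] // E.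
  - by have [|_] := h q; [lia|rewrite -E; lia].
  - by have [|_] := h p; [lia|rewrite E; lia].
  - by have [|_ <-] := h p; [lia|rewrite E; have [|_ ->] := h q; lia].
split; first split.
- by move=> p pM; apply: h; lia.
- by move=> e eM; have [] := h' e eM; have := nz e eM; move=> ? ? ->//; split=> //; lia.
- by move=> e f eM fM l; apply: h3 => //; [exact: nz|right].
Qed.

Lemma extracted_next i O' Q' x : 0 < i <= M -> extracted i O' Q' ->
  0 < x <= M -> Q' x = 0 ->
  (forall e, 0 < e <= M -> Q' e = 0 -> key_le (rarr s K) (rarr s 6) x e) ->
  extracted i.+1 (upd O' i x) (upd Q' x i).
Proof.
move=> iM [h h' h3] xM x0 xmin; split.
- move=> p pi; rewrite /upd; case: (p =P i) => [->|pn]; first by rewrite eqxx.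
  have [|pM pQ] := h p; first lia.
  by split=> //; case: eqP => // px; move: pQ; rewrite px; lia.
- move=> e eM; rewrite /upd; case: (e =P x) => [->|en]; first by rewrite eqxx.
  have [l E] := h' e eM; split=> [|n0]; first lia.
  by rewrite E //; case: eqP => //; lia.
- move=> e f eM fM; rewrite /upd; case: (e =P x) => [->|en]; case: (f =P x) => [->|fn].
  + by move=> *; exact: key_le_refl.
  + move=> _ [f0|l]; apply: xmin => //; have [] := h' f fM; lia.
  + by move=> e0 _; apply: h3 => //; left.
  + exact: h3.
Qed.

(** Selection sort: the root is a least remaining endpoint, and it is removed by emptying its
    leaf. *)
Lemma run_endpoint_sort :
  run B (endpoint_sort K T O Q) s (600 * M.+1 * m.+1) (fun s' =>
    sorted_ranking (rarr s K) (rarr s 6) (warr s' O) (warr s' Q)).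
Proof.
pose Inv j (s' : state R) := [/\ env s', 0 < wvar s' 8, wvar s' 8 + j = M.+1,
  extracted (wvar s' 8) (warr s' O) (warr s' Q) &
  tree_of le m (warr s' T) (fun u => (0 < u <= M) && (warr s' Q u == 0))].
have p2 : 0 < 2 ^ m by rewrite expn_gt0.
apply: run_weaken (fun _ h => h).
  apply: run_seq; first exact: run_tree_fill.
  move=> s1 [en1 tr1 q1].
  apply: (run_seq (Q1 := Inv M)).
    apply: wp_run; split; first by rewrite /=; lia.
    split; rewrite //=.
      rewrite /upd /=; split=> [p|e eM|e f eM fM]; rewrite ?q1 ?Q0 //; lia.
    by apply: eq_tree_of tr1 => u; rewrite q1 Q0 eqxx andbT.
  move=> s2 inv; apply: (run_while (Inv := Inv)) inv => j s3 [en i0 ij ex tr].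
  split=> //; have [e1 e2 e3] := en; rewrite /= e3; case: ifP => iM; last first.
    by apply: extracted_all; rewrite (_ : M.+1 = wvar s3 8) //; lia.
  split; first lia.
  have iM' : 0 < wvar s3 8 <= M by lia.
  have [u uM u0] := extracted_lt iM' ex.
  set S := fun u => _ in tr.
  set x := warr s3 T 1.
  have [|||Sx xm xmin] := @tree_of_root le _ S u (@sort_le_refl _ _)
    (@sort_le_trans _ _) (@sort_le_total _ _) _ tr.
  - by case.
  - lia.
  - by rewrite /S u0 eqxx andbT.
  rewrite -/x in Sx xm xmin.
  have /andP[xM /eqP x0] := Sx.
  pose s4 := set_wvar (set_wvar (set_warr (set_warr (set_wvar s3 11 x)
    O (wvar s3 8) x) Q x (wvar s3 8)) 5 x) 6 0.
  have [aT aO aQ] : [/\ warr s4 T = warr s3 T,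
      warr s4 O = upd (warr s3 O) (wvar s3 8) x &
      warr s4 Q = upd (warr s3 Q) x (wvar s3 8)].
    rewrite /s4 /= /upd ![T == _]eq_sym (negPf OT) (negPf QT) !eqxx.
    by rewrite (negPf OQ) [Q == O]eq_sym (negPf OQ).
  apply: (run_seq (Q1 := fun s' => s' = s4)).
    apply: wp_run; rewrite /= /upd /=; repeat split=> //; lia.
  move=> _ ->; apply: run_seq.
    apply: (@run_tree_set T _ le S false s4) => //; last by rewrite aT.
    by move=> s' e; apply: cmpP; rewrite e.
  move=> s5 [tr5 fr]; have en4 : env s4 by [].
  have [en5 i5 o5 q5] := frame_env en4 fr.
  have i5' : wvar s5 8 = wvar s3 8 by rewrite i5.
  apply: wp_run; split; first by rewrite /= i5'; repeat split=> //; lia.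
  rewrite /= i5'; split=> //; rewrite /= ?/upd /= ?addn1 //; first lia.
    rewrite o5 q5 aO aQ; apply: extracted_next => // e eM eQ.
    have := xmin e; rewrite /S eM eQ eqxx /le /sort_le => H.
    have {}H := H (leq_ltn_trans (proj2 (andP eM)) hM) isT.
    by case/orP: H => [/eqP|/andP[]//]; lia.
  apply: eq_tree_of tr5 => v; rewrite q5 aQ /S /upd [wvar s4 5]/=.
  by case: (v =P x) => // ->; lia.
rewrite /=; nia.
Qed.


End Sort.
End EndpointSort.

(** * The main program and its initial phases *)

(* Real arrays 4, 5 and 6 hold the keys of the 2n endpoints.  Word arrays 1, 2 *)
(* and 3 are the trees of the two sorts and of the sweep; 4 and 5 list the     *)
(* endpoints in increasing order of x and y; 6 and 7 are the inverse arrays.   *)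
Definition choose_size : cmd :=
  (WSet 7 ($0 + $0) ;;
   WSet 1 #1 ;;
   While ($1 <= $7) (WSet 1 ($1 * #2)))%prog.

Definition key_step : cmd :=
  (RPut 4 $8 (RGet 0 ($8 - #1)) ;;
   RPut 4 ($0 + $8) (RGet 1 ($8 - #1)) ;;
   RPut 5 $8 (RGet 2 ($8 - #1)) ;;
   RPut 5 ($0 + $8) (RGet 3 ($8 - #1)) ;;
   RSet 0 (RBin RAdd
     (RBin RAdd (RBin RSub (RGet 1 ($8 - #1)) (RGet 0 ($8 - #1)))
                (RBin RSub (RGet 3 ($8 - #1)) (RGet 2 ($8 - #1))))
     (RWord #1)) ;;
   RPut 6 $8 (RBin RSub (RWord #0) (RVar 0)) ;;
   RPut 6 ($0 + $8) (RVar 0) ;;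
   WSet 8 ($8 + #1))%prog.

Definition make_keys : cmd :=
  (WSet 8 #1 ;; While ($8 <= $0) key_step)%prog.

(** Multiplying by the flag writes the y-rank itself on insertion and 0 on deletion. *)
Definition toggle (e : wexp) : cmd :=
  ((WSet 5 7.[e] ;; WSet 6 ($13 * $5)) ;; tree_update 3 ($3 <= $4))%prog.

(** The query precedes the insertion of the rectangle itself. Entries of array 0 are already shifted
    by one, with 0 for a root, so a sibling's entry is copied as it is. *)
Definition find_parent : cmd :=
  (WSet 5 7.[$11] ;;
   prefix_max 3 ;;
   If ($10 <= #0) (WPut 0 ($11 - #1) #0)
     (WSet 12 5.[$10] ;;
      If ($12 <= $0) (WPut 0 ($11 - #1) $12)
        (WPut 0 ($11 - #1) 0.[$12 - $0 - #1])) ;;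
   WSet 13 #1 ;;
   WSet 12 $11)%prog.

Definition sweep_step : cmd :=
  (WSet 11 4.[$8] ;;
   If ($11 <= $0) find_parent (WSet 13 #0 ;; WSet 12 ($11 - $0)) ;;
   toggle $12 ;;
   toggle ($0 + $12) ;;
   WSet 8 ($8 + #1))%prog.

Definition sweep : cmd := (WSet 8 #1 ;; While ($8 <= $7) sweep_step)%prog.

Section MainProgram.
Local Open Scope nat_scope.
Variables (R : realType) (B n : nat).
Hypothesis hB : 8 * n + 12 < B.

(** The last doubling starts from at most 2n, whence 4n; the extra 1 covers [n = 0], where no
    doubling takes place. *)
Lemma run_choose_size (s : state R) : wvar s 0 = n ->
  run B choose_size s (20 * (trunc_log 2 (n + n) + 2)) (fun s' =>
    wvar s' 7 = n + n /\ exists m, [/\ m <= (trunc_log 2 (n + n)).+1,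
      wvar s' 1 = 2 ^ m, n + n < 2 ^ m & 2 ^ m <= 4 * n + 1]).
Proof.
move=> h0; set L := trunc_log 2 (n + n).
pose Inv j (s' : state R) := wvar s' 7 = n + n /\
  exists i, [/\ i + j = L.+1, wvar s' 1 = 2 ^ i & 2 ^ i <= 4 * n + 1].
apply: run_weaken (fun _ h => h).
  apply: (run_seq (Q1 := fun s' => wvar s' 7 = n + n)).
    by apply: wp_run; rewrite /= h0; split=> //; split=> //; lia.
  move=> s1 h7; apply: (run_seq (Q1 := Inv L.+1)).
    apply: wp_run; rewrite /=; split; first lia.
    by split=> //; exists 0; split=> //; lia.
  move=> s2 inv; apply: (run_while (Inv := Inv)) inv => j s3 [e7 [i [ij e1 ib]]].
  split=> //; rewrite /= e1 e7; case: ifP => iM; last first.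
    by split=> //; exists i; split=> //; [lia|rewrite ltnNge iM].
  have iL : i <= L by apply: trunc_log_max.
  split; first lia.
  apply: wp_run; rewrite /= e1; split; first by split=> //; lia.
  by split=> //; exists i.+1; rewrite expnSr; split=> //; lia.
by rewrite /=; lia.
Qed.

Lemma run_make_keys (s : state R) : wvar s 0 = n ->
  run B make_keys s (200 * n.+1) (fun s' =>
    is_key n (rarr s) 0 1 (rarr s' 4) (rarr s' 6) /\
    is_key n (rarr s) 2 3 (rarr s' 5) (rarr s' 6)).
Proof.
move=> h0; pose c := rarr s.
pose Inv j (s' : state R) := [/\ wvar s' 0 = n, 0 < wvar s' 8,
  wvar s' 8 + j = n.+1, (forall a, a < 4 -> rarr s' a = c a) &
  forall g, 0 < g < wvar s' 8 ->
  [/\ rarr s' 4 g = c 0 g.-1, rarr s' 4 (n + g) = c 1 g.-1,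
      rarr s' 5 g = c 2 g.-1, rarr s' 5 (n + g) = c 3 g.-1 &
      rarr s' 6 g = (- girth c g)%R /\ rarr s' 6 (n + g) = girth c g]].
apply: run_weaken (fun _ h => h).
  apply: (run_seq (Q1 := Inv n)).
    by apply: wp_run; split; [rewrite /=; lia|split=> //= g; rewrite /upd /=; lia].
  move=> s2 inv; apply: (run_while (Inv := Inv)) inv => j s3 [e0 i0 ij ca key].
  split=> //; rewrite /= e0; case: ifP => iM; last first.
    by split=> g gn; have [|k1 k2 k3 k4 [k5 k6]] := key g; [lia|split|lia|split].
  split; first lia.
  set i := wvar s3 8 in i0 ij key iM *.
  apply: wp_run; rewrite /= e0 -/i.
  do 4 (split; [by repeat split=> //; lia|by repeat split=> //; lia|]).
  split; first by repeat split=> //; lia.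
  do 2 (split; [by repeat split=> //; lia|by repeat split=> //; lia|]).
  split; first by repeat split=> //; lia.
  rewrite /upd /= !(ca 0, ca 1, ca 2, ca 3) //.
  split=> //=; rewrite /upd /=; first lia.
  - lia.
  - by case=> [|[|[|[|]]]] // _; rewrite /= ca.
  - move=> g gi; rewrite sub0r !subn1 -!/(girth c i).
    case: (g =P i) => [->|gn].
      have -> : (i == n + i) = false by lia.
      by rewrite !eqxx.
    have [->->->] : [/\ (g == n + i) = false, (n + g == n + i) = false &
      (n + g == i) = false] by split; lia.
    by apply: key; lia.
by rewrite /=; lia.
Qed.

End MainProgram.

(** * Correctness and cost of the sweep *)

Section Sweep.
Local Open Scope nat_scope.
Variables (R : realType) (B n m : nat) (X Y XO YO : nat -> nat).
Variable inside : rel nat.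
Hypotheses (hB : 2 ^ m * 2 + 8 < B) (hM : n + n < 2 ^ m).
Hypotheses (Xnested : nested_ranks n inside X) (Ynested : nested_ranks n inside Y).
Hypothesis overlap : forall g h, 0 < g <= n -> 0 < h <= n -> g != h ->
  X g <= X (n + h) -> X h <= X (n + g) ->
  Y g <= Y (n + h) -> Y h <= Y (n + g) -> inside g h || inside h g.
Hypotheses (Xranking : ranking (n + n) XO X) (Yranking : ranking (n + n) YO Y).

Let env (s : state R) :=
  [/\ wvar s 0 = n, wvar s 1 = 2 ^ m, wvar s 7 = n + n &
      [/\ warr s 4 = XO, warr s 5 = YO & warr s 7 = Y]].

Let parents_until p (w : nat -> nat) :=
  forall g, 0 < g <= n -> X g < p -> is_parent n inside g (w g.-1).

Lemma owner_bounds f : 0 < f <= n + n -> 0 < owner n f <= n.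
Proof. by rewrite /owner; case: ifP; lia. Qed.

Lemma owner_low g : 0 < g <= n -> owner n g = g.
Proof. by rewrite /owner; case: ifP => //; lia. Qed.

Lemma owner_high g : 0 < g <= n -> owner n (n + g) = g.
Proof. by rewrite /owner; case: ifP; lia. Qed.

(** Event [p] changes the status of its owner alone, hence of two y-ranks: both enter at a left side
    and leave at a right side. *)
Lemma active_rankS p w : 0 < p <= n + n ->
  active_rank n X YO p.+1 w =
    if w == Y (n + owner n (XO p)) then XO p <= n
    else if w == Y (owner n (XO p)) then XO p <= n else active_rank n X YO p w.
Proof.
move=> pM; have [eM eX] := Xranking.1 p pM; set e := XO p in eM eX *.
set g := owner n e; have gn : 0 < g <= n by exact: owner_bounds.
have actg : active n X p.+1 g = (e <= n).
  have := Xnested.1 g gn; rewrite /active; move: eX; rewrite /g /owner.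
  by case: ifP => en <-; rewrite ?subnKC; lia.
have [|y1 y2] := Yranking.2 (n + g); first lia.
have [|y3 y4] := Yranking.2 g; first lia.
rewrite /active_rank; case: eqP => [->|w1]; first by rewrite y2 owner_high // actg y1.
case: eqP => [->|w2]; first by rewrite y4 owner_low // actg y3.
case wM: (0 < w <= n + n) => //=; have [fM fY] := Yranking.1 w wM.
set f := YO w in fM fY *; set h := owner n f.
have hn : 0 < h <= n by exact: owner_bounds.
have hg : h <> g.
  move=> E; move: fY; have [->|->] : f = g \/ f = n + g; last 2 first.
  - by move=> /esym.
  - by move=> /esym.
  by rewrite -E /h /owner; case: ifP; lia.
have x1 : X h <> p.
  move=> E; have [|_] := Xranking.2 h; first lia.
  by rewrite E -/e => eh; apply: hg; rewrite /g eh owner_low.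
have x2 : X (n + h) <> p.
  move=> E; have [|_] := Xranking.2 (n + h); first lia.
  by rewrite E -/e => eh; apply: hg; rewrite /g eh owner_high.
by rewrite /active; lia.
Qed.

Lemma run_toggle e (S : pred nat) b (s : state R) :
  env s -> wsafe B s e -> 0 < wval s e <= n + n -> wvar s 13 = nat_of_bool b ->
  tree_of leq m (warr s 3) S ->
  run B (toggle e) s (wcost e + 70 * m.+1) (fun s' =>
    tree_of leq m (warr s' 3) (fun u => if u == Y (wval s e) then b else S u) /\
    frame (toggle e) s s').
Proof.
move=> [e0 e1 e7 [a4 a5 a7]] se eM e13 tr.
have [yM _] := Yranking.2 _ eM.
pose s1 := set_wvar (set_wvar s 5 (Y (wval s e))) 6 (b * Y (wval s e)).
apply: run_weaken (fun _ h => h).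
  apply: run_frame; apply: (run_seq (Q1 := fun s' => s' = s1)).
    apply: wp_run; rewrite /= a7; split=> //; rewrite /upd /= e13.
    by split=> //; split=> //; case: (b); lia.
  move=> _ ->.
  apply: run_weaken (leqnn _) _.
    apply: (@run_tree_set _ _ _ hB 3 _ leq S b s1) => //.
    - by rewrite /s1 /= /upd /=; lia.
    - by rewrite /s1 /= /upd /=; case: (b); rewrite ?mul1n ?mul0n.
  by move=> s2 [].
by rewrite /=; lia.
Qed.

Lemma run_find_parent (s : state R) p g : env s -> wvar s 8 = p ->
  wvar s 11 = g -> 0 < g <= n -> X g = p ->
  tree_of leq m (warr s 3) (active_rank n X YO p) ->
  parents_until p (warr s 0) ->
  run B find_parent s (150 * m.+1) (fun s' =>
    [/\ wvar s' 13 = 1, wvar s' 12 = g, parents_until p.+1 (warr s' 0) &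
      frame find_parent s s']).
Proof.
move=> [e0 e1 e7 [a4 a5 a7]] e8 e11 gn gp tr par.
have [yM yE] : 0 < Y g <= n + n /\ YO (Y g) = g by apply: Yranking.2; lia.
apply: run_weaken (leqnn _) _; first apply: (@run_frame _ _ _ _ _ (fun s' =>
    [/\ wvar s' 13 = 1, wvar s' 12 = g & parents_until p.+1 (warr s' 0)])).
  apply: run_weaken (fun _ h => h).
    apply: (run_seq (Q1 := fun s' => s' = set_wvar s 5 (Y g))).
      by apply: wp_run; rewrite /= a7 e11.
    move=> _ ->; apply: run_seq.
      apply: run_frame; apply: (@run_prefix_max _ _ 3 m (active_rank n X YO p)
        (set_wvar s 5 (Y g))) => //=.
      by rewrite /upd /=; lia.
    move=> s1 [[hres hmax] [fw fa fr]].
    rewrite [wvar _ 5]/= /upd /= in hres hmax.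
    have [[e0' e8' e11'] [a0' a5']] :
      [/\ wvar s1 0 = n, wvar s1 8 = p & wvar s1 11 = g] /\
      (warr s1 0 = warr s 0 /\ warr s1 5 = YO).
      by rewrite !fw // !fa.
    set w := warr s 0 in par a0'; rewrite -gp in par hres hmax.
    have := @parent_from_predecessor n X Y YO inside Xnested Ynested overlap Yranking
      (fun g => w g.-1) g (wvar s1 10) gn par hres hmax.
    set o := (if _ then _ else _) => oP.
    apply: (run_seq (Q1 := fun s' => wvar s' 11 = g /\ warr s' 0 = upd w g.-1 o)).
      apply: wp_run; rewrite /= e11' leqn0; split; first by split=> //; lia.
      rewrite /o; case: eqP => [_|r0].
        split; [by repeat split=> //; lia|by repeat split=> //; lia|].
        by rewrite /upd /= ?e11' a0' ?subn1.
      have [rM _] : 0 < YO (wvar s1 10) <= n + n /\ Y (YO (wvar s1 10)) = wvar s1 10.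
        by apply: Yranking.1; case: hres => // -[_ /andP[]].
      split=> //; rewrite /upd /= a5' e0' e11'; split=> //; case: ifP => fn.
        split; [by repeat split=> //; lia|by repeat split=> //; lia|].
        by rewrite /upd /= ?e11' a0' ?subn1 ?fn.
      split; [by split=> //; lia|by repeat split=> //; lia|].
      by rewrite /upd /= ?e11' a0' ?subn1 ?fn.
    move=> s2 [e11'' a0'']; apply: wp_run; rewrite /= /upd /=; split; first lia.
    split=> //; split=> //; rewrite a0'' => h hn hp.
    case: (eqVneq h g) => [->|hg]; first by rewrite /upd eqxx.
    rewrite /upd ifN; last by lia.
    apply: par => //; rewrite ltnS leq_eqVlt -gp in hp.
    (* Distinct events have distinct x-ranks, so [g] is the only new rectangle to have a parent
       recorded. *)
    case/orP: hp => // /eqP E; case/eqP: hg.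
    have [|_ <-] := Xranking.2 h; first lia.
    by rewrite E; have [|_ ->] := Xranking.2 g; first lia.
  by rewrite /=; lia.
by move=> s' [[]].
Qed.

Let frame_env c s1 s2 : all (fun x => x \notin wvar_mods c) [:: 0; 1; 7] ->
  all (fun a => a \notin warr_mods c) [:: 4; 5; 7] -> env s1 -> frame c s1 s2 ->
  env s2.
Proof.
move=> /and4P[w0 w1 w7 _] /and4P[a4 a5 a7 _] es [fw fa _].
by case: es => ? ? ? [? ? ?]; split; [..|split]; rewrite ?fw ?fa.
Qed.

Lemma run_sweep_step (s : state R) p : env s -> wvar s 8 = p -> 0 < p <= n + n ->
  tree_of leq m (warr s 3) (active_rank n X YO p) ->
  parents_until p (warr s 0) ->
  run B sweep_step s (400 * m.+1) (fun s' =>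
    [/\ env s', wvar s' 8 = p.+1,
      tree_of leq m (warr s' 3) (active_rank n X YO p.+1) &
      parents_until p.+1 (warr s' 0)]).
Proof.
move=> es e8 pM tr par; have [eM eX] := Xranking.1 p pM.
set e := XO p in eM eX; pose g := owner n e.
have gn : 0 < g <= n by exact: owner_bounds.
have [_ _ _ [a4 _ _]] := es.
apply: run_weaken (fun _ h => h).
  apply: (run_seq (Q1 := fun s' => s' = set_wvar s 11 e)).
    by apply: wp_run; rewrite /= a4 e8.
  move=> _ ->; set s1 := set_wvar s 11 e; have es1 : env s1 by [].
  apply: (run_seq (Q1 := fun s' => [/\ env s', wvar s' 8 = p, warr s' 3 = warr s 3 &
     [/\ wvar s' 13 = nat_of_bool (e <= n), wvar s' 12 = g &
         parents_until p.+1 (warr s' 0)]])).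
    apply: (@run_if _ _ _ _ _ _ (150 * m.+1)) => //.
    rewrite [bval _ _]/= /upd /=; have [-> _ _ _] := es; case: ifP => en.
      have ge : g = e by rewrite /g /owner en.
      apply: run_weaken (leqnn _) _.
        by apply: (@run_find_parent s1 p g) => //; rewrite ge.
      move=> s2 [h13 h12 h0 fr]; split=> //.
      - by apply: frame_env fr.
      - by case: fr => [-> // _ _].
      - by case: fr => [_ -> // _].
    apply: run_weaken (wp_run _) _ (fun _ h => h); last by rewrite /=; lia.
    rewrite /= /upd /=; have [-> _ _ _] := es; split; first lia.
    split; first by repeat split=> //; lia.
    split=> //; split=> //; first by rewrite /g /owner en.
    move=> h hn hp; apply: par => //.
    rewrite ltnS leq_eqVlt in hp; case/orP: hp => // /eqP E.
    by have [|_] := Xranking.2 h; [lia|rewrite E -/e; lia].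
  move=> s2 [es2 e8' a3 [h13 h12 h0]]; have [w0 _ _ _] := es2.
  apply: run_seq.
    by apply: (run_toggle (S := active_rank n X YO p) (b := e <= n) es2) => //;
      rewrite ?a3 //= h12; lia.
  move=> s3 [tr3 fr3]; have es3 : env s3 by apply: frame_env es2 fr3.
  have [w8 w12 w13 a0] : [/\ wvar s3 8 = p, wvar s3 12 = g,
     wvar s3 13 = nat_of_bool (e <= n) & warr s3 0 = warr s2 0].
    by case: fr3 => [fw fa _]; rewrite !fw // fa.
  have [w0' _ _ _] := es3.
  apply: run_seq.
    by apply: (run_toggle (b := e <= n) es3 _ _ _ tr3) => //=; rewrite w0' w12;
      repeat split=> //; lia.
  move=> s4 [tr4 fr4]; have es4 : env s4 by apply: frame_env es3 fr4.
  have [w8' a0'] : wvar s4 8 = p /\ warr s4 0 = warr s3 0.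
    by case: fr4 => [fw fa _]; rewrite !fw // fa.
  apply: wp_run; rewrite /= w8'; split; first by repeat split=> //; lia.
  split=> //; rewrite /= /upd /= ?a0' ?a0 ?addn1 //.
  apply: eq_tree_of tr4 => u; rewrite active_rankS // -/e -/g /= w0' w12 h12.
  by [].
by rewrite /=; lia.
Qed.

Lemma run_sweep (s : state R) : env s -> (forall i, warr s 3 i = 0) ->
  run B sweep s (500 * (n + n).+1 * m.+1) (fun s' =>
    forall g, 0 < g <= n -> is_parent n inside g (warr s' 0 g.-1)).
Proof.
move=> es t0.
pose Inv j (s' : state R) := [/\ env s', wvar s' 8 + j = (n + n).+1 /\ 0 < wvar s' 8,
  tree_of leq m (warr s' 3) (active_rank n X YO (wvar s' 8)) &
  parents_until (wvar s' 8) (warr s' 0)].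
have p2 : 0 < 2 ^ m by rewrite expn_gt0.
apply: run_weaken (fun _ h => h).
  apply: (run_seq (Q1 := Inv (n + n))).
    apply: wp_run; rewrite /=; split; first lia.
    split=> //=; rewrite /upd /=.
      (* Ranks start at 1, so nothing is active before the first event. *)
      apply: eq_tree_of (tree_of_pred0 _ _ t0) => u; apply/esym/negbTE.
      rewrite /active_rank; case uM: (0 < u <= n + n) => //=.
      have [fM _] := Yranking.1 u uM; have hn := owner_bounds fM.
      by rewrite /active; have [|] := Xranking.2 (owner n (YO u)); lia.
    by move=> g gn gp; have [|] := Xranking.2 g; lia.
  move=> s1 inv; apply: (run_while (Inv := Inv)) inv => j s2 [es2 [ij i0] tr par].
  have [_ _ w7 _] := es2; split=> //; rewrite /= w7; case: ifP => iM; last first.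
    by move=> g gn; apply: par => //; have [|] := Xranking.2 g; lia.
  split; first lia.
  apply: run_weaken (leqnn _) _; first by apply: (run_sweep_step es2 erefl) => //; lia.
  by move=> s3 [es3 w8 tr3 par3]; split; rewrite ?w8 //; lia.
by rewrite /=; nia.
Qed.

End Sweep.

(** * The whole program, its time bound and the theorem *)

Definition forest_program : cmd :=
  (choose_size ;; make_keys ;; endpoint_sort 4 1 4 6 ;; endpoint_sort 5 2 5 7 ;;
   sweep)%prog.

Definition forest_time (n : nat) : nat := 4000 * n.+1 * (trunc_log 2 (n + n) + 3).

(** The x-ranks [X] are exported as the measure for the induction in [parent_forest]. *)
Lemma run_forest_program (R : realType) (n : nat) (r : 'I_n -> rectangle R) :
  injective (fun i => region (r i)) ->
  laminar (range (fun i => region (r i))) ->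
  run (n.+2 ^ 5) forest_program (input r) (forest_time n) (fun s =>
    exists2 X : nat -> nat, nested_ranks n (inside (rarr (input r))) X &
    forall g, (0 < g <= n)%N ->
      is_parent n (inside (rarr (input r))) g (warr s 0%N g.-1)).
Proof.
move=> inj lam; set B := (n.+2 ^ 5)%N; set s0 := input r; set c := rarr s0.
have hB : (8 * n + 12 < B)%N.
  have : (2 ^ 4 * n.+2 <= B)%N.
    by rewrite /B [in X in (_ <= X)%N]expnSr leq_mul // leq_exp2r.
  lia.
set L := trunc_log 2 (n + n).
apply: run_weaken (fun _ h => h).
  apply: run_seq; first exact: run_frame (run_choose_size (s := s0) hB erefl).
  move=> s1 [[w7 [m [mL w1 nm mn]]] [fw1 fa1 fr1]].
  have w0 : wvar s1 0 = n by rewrite fw1.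
  have r1 : rarr s1 = c by apply: funext => a; rewrite fr1.
  have a1 a : warr s1 a = fun=> 0%N by rewrite fa1.
  have hB' : (2 ^ m * 2 + 8 < B)%N by lia.
  have mL1 : (m.+1 <= L + 2)%N by lia.
  apply: run_seq; first exact: run_frame (run_make_keys hB w0).
  move=> s2 [+ [fw2 fa2 fr2]]; rewrite r1 => -[keyX keyY].
  have {}w0 : wvar s2 0 = n by rewrite fw2.
  have {}w1 : wvar s2 1 = (2 ^ m)%N by rewrite fw2.
  have {}w7 : wvar s2 7 = (n + n)%N by rewrite fw2.
  have a2 a : warr s2 a = fun=> 0%N by rewrite fa2 // a1.
  apply: run_seq.
    apply: run_weaken; first apply: run_frame.
    - by apply: (@run_endpoint_sort R B m hB' 4 1 4 6 (n + n) s2) => // i; rewrite a2.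
    - by apply: leq_mul (leqnn _) mL1.
    - by move=> s h; exact: h.
  move=> s3 [[rkX srtX] [fw3 fa3 fr3]].
  apply: run_seq.
    apply: run_weaken; first apply: run_frame.
    - by apply: (@run_endpoint_sort R B m hB' 5 2 5 7 (n + n) s3) => //;
        rewrite ?fw3 // => i; rewrite fa3 // a2.
    - by apply: leq_mul (leqnn _) mL1.
    - by move=> s h; exact: h.
  move=> s4 [[rkY srtY] [fw4 fa4 fr4]].
  rewrite !fr3 // in srtY.
  have Xn : nested_ranks n (inside c) (warr s3 6).
    apply: (sorted_nested_ranks inj keyX) => //; last by move=> g h /and5P[].
    case=> // g gn; have [-> -> _ _] := inputE r (Ordinal gn); exact: xmin_le_xmax.
  have Yn : nested_ranks n (inside c) (warr s4 7).
    apply: (sorted_nested_ranks inj keyY) => //; last by move=> g h /and5P[].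
    case=> // g gn; have [_ _ -> ->] := inputE r (Ordinal gn); exact: ymin_le_ymax.
  have ov := inside_overlap lam keyX keyY srtX srtY.
  apply: run_weaken.
  - apply: (@run_sweep R B n m (warr s3 6) (warr s4 7) (warr s4 4) (warr s4 5)
      (inside c)) => //.
    + by rewrite fa4.
    + by rewrite !fw4 // !fw3.
    + by move=> i; rewrite fa4 // fa3 // a2.
  - by apply: leq_mul (leqnn _) mL1.
  - by move=> s par; exists (warr s3 6).
rewrite /forest_time -/L; nia.
Qed.

(** For [n >= 2], the truncated logarithm times [ln 2] is at most [ln (2n) <= 2 ln n]; together with
    [3 ln 2 <= 3 ln n] and [n + 1 <= 2n] this gives the factor 10. *)
Lemma linearithmic_O (R : realType) (C : nat) :
  (fun n : nat => (C * n.+1 * (trunc_log 2 (n + n) + 3))%:R : R^o) =O_\oo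
    (fun n : nat => n%:R * ln (n%:R : R) : R^o).
Proof.
have l2 : 0 < ln (2 : R) by rewrite ln_gt0 // ltr1n.
have C0 : 0 <= (C%:R : R) by [].
(* The summand 1 keeps the constant positive when [C = 0]. *)
apply/eqO_exP; exists ((10 * C%:R + 1) / ln 2).
  by rewrite divr_gt0 //; lra.
near=> n.
have n2 : (2 <= n)%N by near: n; exact: nbhs_infty_ge.
have n0 : 0 < (n%:R : R) by rewrite ltr0n; lia.
have lnn : ln 2 <= ln (n%:R : R) by rewrite ler_ln ?posrE // ler_nat.
have tl : (trunc_log 2 (n + n))%:R * ln (2 : R) <= 2 * ln n%:R.
  rewrite mulr_natl -lnXn // -natrX.
  apply: (@le_trans _ _ (ln ((n + n)%:R))).
    rewrite ler_ln ?posrE ?ltr0n ?expn_gt0 //; last by lia.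
    by rewrite ler_nat trunc_logP //; lia.
  have -> : (n + n)%:R = 2 * n%:R :> R by rewrite natrD; ring.
  by rewrite lnM ?posrE //; lra.
rewrite !ger0_norm ?mulr_ge0 ?ler0n //; last by lra.
rewrite !natrM natrD.
move: tl lnn; set t := (trunc_log _ _)%:R; set l := ln n%:R => tl lnn.
have n1 : (n.+1)%:R <= 2 * (n%:R : R) by rewrite -natrM ler_nat; lia.
have l0 : 0 <= l by lra.
rewrite [leRHS]mulrAC ler_pdivlMr //.
rewrite [leLHS](_ : _ = C%:R * n.+1%:R * ((t + 3) * ln 2)); last by ring.
apply: (@le_trans _ _ (C%:R * (2 * n%:R) * (5 * l))).
  apply: ler_pM.
  - by rewrite mulr_ge0.
  - by rewrite mulr_ge0 ?addr_ge0 // ltW.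
  - by rewrite ler_wpM2l.
  - lra.
have nl : 0 <= n%:R * l by rewrite mulr_ge0.
rewrite [X in X <= _](_ : _ = 10 * C%:R * (n%:R * l)); last by ring.
rewrite [X in _ <= X](_ : _ = 10 * C%:R * (n%:R * l) + n%:R * l); last by ring.
by rewrite lerDl.
Unshelve. all: by end_near.
Qed.

(* With n input rectangles, words are the naturals below (n + 2) ^ k, that is, *)
(* they have O(log n) bits.                                                    *)
Theorem lemma2p1 (R : realType) :
  exists (prog : cmd) (k : nat) (T : nat -> nat),
    ((fun n : nat => (T n)%:R : R^o) =O_\oo
       (fun n : nat => n%:R * ln (n%:R : R) : R^o)) /\
    forall (n : nat) (r : 'I_n -> rectangle R),
      injective (fun i => region (r i)) ->
      laminar (range (fun i => region (r i))) ->
      exists (s : state R) (t : nat) (p : 'I_n -> option 'I_n),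
        [/\ exec (n.+2 ^ k)%N prog (input r) s t,
            (t <= T n)%N,
            outputs s p
          & inclusion_forest (fun i => region (r i)) p].
Proof.
exists forest_program, 5%N, forest_time; split; first exact: linearithmic_O.
move=> n r inj lam.
have [s [t [ex le_t [X Xn par]]]] := run_forest_program inj lam.
have [out forest] := parent_forest Xn par.
by exists s, t, (parent_of (warr s 0%N)).
Qed.
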